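(* Let $A$ be an $n\times n$ complex matrix with eigenvalues $\lambda_1,\dots,\lambda_n$ (with multiplicity), let $m\le n$ be a positive integer, and let $\sigma\in S_m$. Define $$I(A,\sigma)=\int_{U_n}\prod_{i=1}^{m}A^u_{i\,\sigma(i)}\,du .$$ Then $$I(A,\sigma)=\sum_{\eta\vdash m}\frac{s_\eta(\lambda_1,\dots,\lambda_n)}{s_\eta(1,1,\dots,1)}\,\frac{\chi_\eta(e)}{m!}\,\chi_\eta(\sigma),$$ where the sum is over all partitions $\eta$ of $m$.
   Context: $du$ is the normalized Haar measure on the unitary group $U_n$, and $A^u=uAu^{*}$ for $u\in U_n$. For a partition $\eta$ of $m$, $\chi_\eta$ is the irreducible character of the symmetric group $S_m$ indexed by $\eta$ (with $\chi_{(m)}$ trivial), $e$ is the identity of $S_m$, and $s_\eta$ is the Schur polynomial in $n$ variables indexed by $\eta$; $s_\eta(1,1,\dots,1)$ is its value at $n$ ones. *)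

(* Defs.v *)
From HB Require Import structures.
From mathcomp Require Import all_boot all_order all_fingroup all_algebra.
From mathcomp Require Import mxrepresentation spectral complex.
From mathcomp Require Import all_classical all_reals all_analysis.

Set Implicit Arguments.
Unset Strict Implicit.
Unset Printing Implicit Defensive.

Import Order.TTheory GRing.Theory Num.Theory.
Import numFieldTopology.Exports.

Local Open Scope ring_scope.
Local Open Scope sesquilinear_scope.
Local Open Scope complex_scope.
Local Open Scope classical_set_scope.

(* The library puts the topology of the norm on abstract numFieldTypes only;
   this makes it canonical on the concrete complex field. *)
HB.instance Definition _ (R : rcfType) :=
  PseudoPointedMetric.copy R[i] (R[i])^o.

Section UnitaryGroup.
Variables (R : realType) (n : nat).

Definition unitary_mxs : set 'M[R[i]]_n := [set u | u \is unitarymx].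

(* The unitary group, with the subspace topology of 'M[R[i]]_n *)
Definition unitary : Type := set_type unitary_mxs.
HB.instance Definition _ := Topological.on unitary.

Definition unitary_mx (u : unitary) : 'M[R[i]]_n := set_val u.

Lemma unitary_mxP (u : unitary) : unitary_mx u \is unitarymx.
Proof. exact: (set_mem (valP u)). Qed.

Lemma unitary_id_subproof : (1%:M : 'M[R[i]]_n) \in unitary_mxs.
Proof. by apply/mem_set/unitarymxP; rewrite trmx1 map_mx1 mulmx1. Qed.

Lemma unitary_mul_subproof (u v : unitary) :
  unitary_mx u *m unitary_mx v \in unitary_mxs.
Proof. by apply/mem_set/mul_unitarymx; exact: unitary_mxP. Qed.

Definition unitary_id : unitary :=
  @exist _ (fun x => x \in unitary_mxs) _ unitary_id_subproof.
Definition unitary_mul (u v : unitary) : unitary :=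
  @exist _ (fun x => x \in unitary_mxs) _ (unitary_mul_subproof u v).

HB.instance Definition _ := isPointed.Build unitary unitary_id.

Definition unitary_borel := g_sigma_algebraType (@open unitary).

(* On a compact metrisable group such as the unitary group, a Borel
   probability measure is automatically regular, and left invariance
   characterises the normalized Haar measure. *)
Definition normalized_haar (mu : probability unitary_borel R) : Prop :=
  forall (g : unitary) (S : set unitary_borel),
    measurable S -> mu (unitary_mul g @` S) = mu S.

Definition complex_integral (mu : probability unitary_borel R)
    (f : unitary_borel -> R[i]) : R[i] :=
  (\int[mu]_(u in setT) complex.Re (f u)) +i*
  (\int[mu]_(u in setT) complex.Im (f u)).

Definition unitary_conj (A : 'M[R[i]]_n) (u : unitary) : 'M[R[i]]_n :=
  unitary_mx u *m A *m (unitary_mx u)^t*.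

End UnitaryGroup.

Section Partitions.
Variable m : nat.

(* A partition of m has at most m parts, each at most m; it is encoded as its
   list of m parts, padded with zeros. *)
Definition is_partition (eta : {ffun 'I_m -> 'I_m.+1}) : bool :=
  [forall i : 'I_m, forall j : 'I_m, (i <= j)%N ==> (eta j <= eta i)%N]
  && (\sum_(i < m) eta i == m)%N.

Variable eta : {ffun 'I_m -> 'I_m.+1}.

(* (row, column), numbered from 0, in the Young diagram of eta *)
Definition cell := {c : 'I_m * 'I_m | (c.2 < eta c.1)%N}.

Definition semistandard (n : nat) (T : {ffun cell -> 'I_n}) : bool :=
  [forall c : cell, forall d : cell,
    (((val c).1 == (val d).1) && ((val c).2 <= (val d).2)%N
       ==> (T c <= T d)%N) &&
    (((val c).2 == (val d).2) && ((val c).1 < (val d).1)%N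
       ==> (T c < T d)%N)].

Definition schur (K : comNzRingType) (n : nat) (x : 'I_n -> K) : K :=
  \sum_(T : {ffun cell -> 'I_n} | semistandard T) \prod_(c : cell) x (T c).

(* Row and column of the entry k in the tableau of shape eta that is filled
   with 0, ..., m-1 along the rows, from top to bottom *)
Definition tab_row (k : 'I_m) : nat :=
  reshape_index [seq val (eta i) | i <- enum 'I_m] k.
Definition tab_col (k : 'I_m) : nat :=
  reshape_offset [seq val (eta i) | i <- enum 'I_m] k.

Definition row_stab : {set 'S_m} :=
  [set s : 'S_m | [forall k, tab_row (s k) == tab_row k]].
Definition col_stab : {set 'S_m} :=
  [set s : 'S_m | [forall k, tab_col (s k) == tab_col k]].

Variable F : fieldType.
Let Sm := [set: 'S_m]%G.
Let reg := regular_repr F Sm.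

(* The Young symmetrizer, an element of the group algebra F[S_m] in its
   regular representation *)
Definition young_symmetrizer : 'M[F]_#|Sm| :=
  (\sum_(p in row_stab) reg p) *m
  (\sum_(q in col_stab) (-1) ^+ (q : bool) *: reg q).

(* The Specht module: the right ideal of F[S_m] generated by the Young
   symmetrizer. In characteristic 0 these are the irreducible modules of S_m;
   the one-row partition gives the trivial module. *)
Definition specht_mod := cyclic_mx reg (gring_row young_symmetrizer).

Definition specht_repr : mx_representation F Sm (\rank specht_mod) :=
  submod_repr (cyclic_mx_module reg (gring_row young_symmetrizer)).

Definition sym_char (s : 'S_m) : F := \tr (specht_repr s).

End Partitions.

(* Main.v *)
(* Let E be the integral of the m-th tensor power of A^u, a matrix indexed by
   the words w : {1..m} -> {1..n}.  By invariance of the measure, E commutes with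
   the tensor powers of all unitary matrices, hence (diagonal, then Hermitian,
   then arbitrary matrices, the last by a polynomial identity) with those of all
   matrices.  As m <= n there is a word w0 without repetitions, and commutation
   with the matrix of a map phi expresses row phi o w0 of E through row w0; thus
   E = sum_g E(w0, w0 g) g belongs to the image of the group algebra of S_m.

   The Young symmetrizers c_eta = (row sum)(column sum) satisfy c x c in F c,
   c_eta x c_nu = 0 for eta <> nu and c^2 = kappa c with kappa = m! / chi_eta(e),
   and kappa chi_eta(s) is the sum over g in S_m of the coefficients of c at
   g s^-1 g^-1.  The sums z_eta of the conjugates of c_eta, divided by kappa^2, are
   orthogonal central idempotents.  On the space of words their traces are the
   products of ranks dim(S^eta) rank(c_eta), which sum to at most n^m.  A
   triangularity argument gives dim(S^eta) >= f^eta (the number of standard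
   tableaux) and rank(c_eta) >= s_eta(1,...,1), and
   sum_eta f^eta s_eta(1,...,1) >= n^m by Pieri's rule.  So equality holds
   throughout: the idempotents sum to 1 and the rows of c_eta indexed by
   semistandard tableaux form a basis of its row space, consisting of eigenvectors
   of the tensor powers of diagonal matrices.  Hence the trace of c_eta against
   the tensor power of A is kappa s_eta(lambda).

   Finally E c_eta = phi c_eta for a scalar phi, which the trace identifies as
   s_eta(lambda) / s_eta(1,...,1), and entry (w0, w0 o sigma) of
   E = sum_eta phi_eta z_eta / kappa^2 is the claim. *)

Require Import Defs.
From mathcomp Require Import all_boot all_order all_fingroup all_algebra.
From mathcomp Require Import mxrepresentation spectral complex zify.
From mathcomp Require Import all_classical all_reals all_analysis measurable_realfun.

Set Implicit Arguments.
Unset Strict Implicit.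
Unset Printing Implicit Defensive.

Import Order.TTheory GRing.Theory Num.Theory.

Local Open Scope ring_scope.
Local Open Scope complex_scope.
Local Open Scope sesquilinear_scope.

(** * Linear algebra *)

(* If X = C B is a rank factorization of X, then X^2 = k X means B C = k. *)
Lemma mxtrace_quasi_idem (F : fieldType) N (X Z : 'M[F]_N) k r
    (B : 'M[F]_(r, N)) Y :
  X *m X = k *: X -> row_free B -> (B :=: X)%MS -> B *m Z = Y *m B ->
  \tr (X *m Z) = k * \tr Y.
Proof.
move=> XX fB eqBX BZ.
have /submxP[C defX] : (X <= B)%MS by rewrite eqBX.
have /submxP[D defB] : (B <= X)%MS by rewrite eqBX.
have BC : B *m C = k%:M.
  apply: (row_free_inj fB); rewrite -mulmxA -defX mul_scalar_mx {1}defB.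
  by rewrite -mulmxA XX -scalemxAr -defB.
by rewrite defX -mulmxA BZ mulmxA mxtrace_mulC mulmxA BC mul_scalar_mx mxtraceZ.
Qed.

Lemma mxtrace_quasi_idem_rank (F : fieldType) N (X : 'M[F]_N) k :
  X *m X = k *: X -> \tr X = k * (\rank X)%:R.
Proof.
move=> XX; rewrite -[in LHS](mulmx1 X).
rewrite (mxtrace_quasi_idem XX (row_base_free X) (eq_row_base X) (Y := 1%:M)).
  by rewrite mxtrace1.
by rewrite mulmx1 mul1mx.
Qed.

Lemma mxtrace_sum (F : comNzRingType) N (I : finType) (P : pred I)
    (M : I -> 'M[F]_N) :
  \tr (\sum_(i | P i) M i) = \sum_(i | P i) \tr (M i).
Proof. exact: raddf_sum. Qed.

Lemma row_diag_mul (F : comNzRingType) N1 N2 (d : 'rV[F]_N1) (A : 'M[F]_(N1, N2)) i :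
  row i (diag_mx d *m A) = d 0 i *: row i A.
Proof. by rewrite row_mul row_diag_mx -scalemxAl -rowE. Qed.

(** * Matrices indexed by finite types *)

Section FinMatrix.
Variable F : comNzRingType.

Definition fmx (X Y : finType) (f : X -> Y -> F) : 'M[F]_(#|X|, #|Y|) :=
  \matrix_(i, j) f (enum_val i) (enum_val j).

Lemma fmxE (X Y : finType) (f : X -> Y -> F) x y :
  fmx f (enum_rank x) (enum_rank y) = f x y.
Proof. by rewrite mxE !enum_rankK. Qed.

Lemma eq_fmx (X Y : finType) (f g : X -> Y -> F) :
  (forall x y, f x y = g x y) -> fmx f = fmx g.
Proof. by move=> fg; apply/matrixP => i j; rewrite !mxE fg. Qed.

Lemma fmx_surj (X Y : finType) (M : 'M[F]_(#|X|, #|Y|)) :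
  M = fmx (fun x y => M (enum_rank x) (enum_rank y)).
Proof. by apply/matrixP => i j; rewrite mxE !enum_valK. Qed.

Lemma fmxM (X Y Z : finType) (f : X -> Y -> F) (g : Y -> Z -> F) :
  fmx f *m fmx g = fmx (fun x z => \sum_y f x y * g y z).
Proof.
apply/matrixP => i j; rewrite !mxE (reindex (@enum_rank Y)) /=.
  by apply: eq_bigr => y _; rewrite !mxE enum_rankK.
by exists enum_val => x _; rewrite ?enum_rankK ?enum_valK.
Qed.

Lemma mxtrace_fmx (X : finType) (f : X -> X -> F) :
  \tr (fmx f) = \sum_x f x x.
Proof.
rewrite /mxtrace (reindex (@enum_rank X)) /=.
  by apply: eq_bigr => y _; rewrite !mxE enum_rankK.
by exists enum_val => x _; rewrite ?enum_rankK ?enum_valK.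
Qed.

Lemma fmx1 (X : finType) : fmx (fun x y : X => (x == y)%:R) = 1%:M.
Proof.
by apply/matrixP => i j; rewrite !mxE (inj_eq enum_val_inj).
Qed.

End FinMatrix.

(** * Young diagrams *)

Section Diagrams.
Variable m : nat.
Implicit Types (r c : 'I_m -> nat) (eta nu : {ffun 'I_m -> 'I_m.+1}).

(* The cells (r k, c k) are distinct and fill a down-closed subset of N x N.
   The notion is invariant under transposition. *)
Definition diagram r c : Prop :=
  (forall k l, r k = r l -> c k = c l -> k = l) /\
  (forall k i j, (i <= r k)%N -> (j <= c k)%N -> exists l, r l = i /\ c l = j).

Lemma card_fibers (A : {set 'I_m}) (g : 'I_m -> nat) N :
  (forall k, g k < N)%N -> #|A| = (\sum_(i < N) #|[set k in A | g k == i]|)%N.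
Proof.
move=> ltgN; rewrite -sum1_card (partition_big (fun k => Ordinal (ltgN k)) xpredT) //=.
by apply: eq_bigr => i _; rewrite -sum1_card; apply: eq_bigl => k; rewrite inE.
Qed.

(** If column [x] of the second diagram reaches row [j], it has a cell in each of the first [j]
    rows, while the left-hand set meets each row at most once. Otherwise the whole column lies in
    the first [j] rows, and [f] embeds the left-hand set into it. *)
Lemma column_card_le r1 c1 r2 c2 (f : 'I_m -> 'I_m) j x :
    diagram r1 c1 -> diagram r2 c2 -> injective f ->
    (forall k l, r1 k = r1 l -> c2 (f k) = c2 (f l) -> k = l) ->
  (#|[set k in [set k | r1 k < j] | c2 (f k) == x]|
     <= #|[set l in [set l | r2 l < j] | c2 l == x]|)%N.
Proof.
move=> _ [_ down2] injf inj12; set A := [set k in _ | _]; set B := [set l in _ | _].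
have [l /andP[/eqP cl rl]|short] :=
    @pickP 'I_m (fun l => (c2 l == x) && (j <= r2 l)%N).
  have leAj : (#|A| <= j)%N.
    (* The type ['I_j.+1] makes [inord] available when [j = 0]; the value [ord_max] is never taken,
       so the bound is [j]. *)
    pose g k : 'I_j.+1 := inord (r1 k).
    have : {in A &, injective g}.
      move=> k k'; rewrite !inE => /andP[rk /eqP ck] /andP[rk' /eqP ck'].
      move=> /(congr1 val); rewrite /= !inordK ?ltnS ?(ltnW rk) ?(ltnW rk') //.
      by move=> /inj12; apply; rewrite ck ck'.
    move/card_in_imset <-.
    have /subset_leq_card : g @: A \subset [set~ ord_max].
      apply/fintype.subsetP => _ /imsetP[k + ->]; rewrite !inE => /andP[rk _].
      by rewrite -val_eqE /= inordK ?ltn_eqF // ltnS ltnW.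
    by rewrite cardsC1 card_ord.
  apply: leq_trans leAj _.
  have /fin_all_exists[h hP] (i : 'I_j) : exists l', r2 l' = i /\ c2 l' = x.
    have := down2 l i x; rewrite cl; apply=> //.
    exact: leq_trans (ltnW (ltn_ord i)) rl.
  have injh : injective h.
    by move=> i i' eqh; apply/ord_inj; rewrite -(hP i).1 -(hP i').1 eqh.
  rewrite -[X in (X <= _)%N]card_ord -(card_imset predT injh).
  apply/subset_leq_card/fintype.subsetP => _ /imsetP[i _ ->].
  by rewrite !inE (hP i).1 (hP i).2 ltn_ord eqxx.
rewrite -(card_imset (mem A) injf); apply/subset_leq_card/fintype.subsetP.
move=> _ /imsetP[k + ->]; rewrite !inE => /andP[_ ck].
by rewrite ck andbT ltnNge; move: (short (f k)); rewrite ck /= => ->.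
Qed.

Lemma bounded_ord (g : 'I_m -> nat) : exists N, forall k, (g k < N)%N.
Proof. by exists (\max_k g k).+1 => k; rewrite ltnS (leq_bigmax k). Qed.

(** [column_card_le] is summed over all columns. The conclusion is the dominance order on shapes,
    which controls when products of row sums and column sums can be nonzero. *)
Lemma row_dominance r1 c1 r2 c2 (f : 'I_m -> 'I_m) j :
    diagram r1 c1 -> diagram r2 c2 -> injective f ->
    (forall k l, r1 k = r1 l -> c2 (f k) = c2 (f l) -> k = l) ->
  (#|[set k | r1 k < j]| <= #|[set l | r2 l < j]|)%N.
Proof.
move=> d1 d2 injf inj12; have [N ltN] := bounded_ord c2.
rewrite (card_fibers _ (fun k => ltN (f k))) (card_fibers _ ltN).
by apply: leq_sum => x _; apply: (column_card_le _ _ d1 d2).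
Qed.

Lemma eq_sum_leq (I : finType) (F G : I -> nat) :
  (forall i, F i <= G i)%N -> (\sum_i G i <= \sum_i F i)%N ->
  forall i, F i = G i.
Proof.
move=> leFG leGF i; apply/eqP; rewrite eqn_leq leFG leqNgt; apply/negP => ltFG.
move: leGF; rewrite leqNgt => /negP; apply.
rewrite (bigD1 i) //= [ltnRHS](bigD1 i) //= -addSn leq_add //.
by apply: leq_sum => k _; apply: leFG.
Qed.

(** For a single diagram the bound of [column_card_le] is an equality, so the row of [k] and the
    column of [g k] always meet in a cell. The permutation [p] sends [k] to that cell, and [q] is
    what remains of [g]. *)
Lemma diagram_factor r c (g : 'S_m) :
    diagram r c -> (forall k l, r k = r l -> c (g k) = c (g l) -> k = l) ->
  exists p q : 'S_m, [/\ forall k, r (p k) = r k, forall k, c (q k) = c k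
                       & g = (p * q)%g].
Proof.
move=> dgm injg; have [N ltN] := bounded_ord c.
have eqc j x : #|[set k in [set k | r k < j]%N | c (g k) == x]|
    = #|[set l in [set l | r l < j]%N | c l == x]|.
  have le1 y := column_card_le j y dgm dgm (@perm_inj _ g) injg.
  have [ltx|leNx] := ltnP x N; last first.
    by apply: eq_card => k; rewrite !inE !ltn_eqF //
      (leq_trans (ltN _) leNx).
  (* Both sides, summed over the columns, count the cells of the first [j] rows; hence the termwise
     inequality is an equality. *)
  apply: (@eq_sum_leq 'I_N (fun y => #|[set k in _ | _ == nat_of_ord y]|)
      (fun y => #|[set k in _ | _ == nat_of_ord y]|) _ _ (Ordinal ltx)) => //.
  by rewrite -(card_fibers _ (fun k => ltN (g k))) -card_fibers.
have ex k : exists l, r l = r k /\ c l = c (g k).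
  have [l /andP[/eqP rl /eqP cl]|none] :=
      @pickP 'I_m (fun l => (r l == r k) && (c l == c (g k))).
    by exists l.
  (* The element [k] makes the left-hand count grow when row [r k] is included; by [eqc] the column
     of [g k] must then have a cell in that row. *)
  suff : (#|[set k' in [set k' | r k' < r k]%N | c (g k') == c (g k)]|
     < #|[set k' in [set k' | r k' < (r k).+1]%N | c (g k') == c (g k)]|)%N.
    rewrite !eqc ltnNge => /negP[]; apply/subset_leq_card/fintype.subsetP => l.
    rewrite !inE ltnS leq_eqVlt => /andP[/orP[rl cl|-> -> //]].
    by move: (none l); rewrite rl cl.
  apply/proper_card/properP; split.
    by apply/fintype.subsetP => l; rewrite !inE => /andP[rl ->]; rewrite ltnW.
  by exists k; rewrite !inE ?ltnn ?eqxx // ltnS leqnn.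
have [p0 p0P] := fin_all_exists ex.
have injp : injective p0.
  by move=> k l eqp; apply: injg; rewrite -?(p0P k).1 -?(p0P k).2 eqp ?(p0P l).1 ?(p0P l).2.
exists (perm injp), ((perm injp)^-1 * g)%g; split=> [k|k|]; last by rewrite mulKVg.
  by rewrite permE (p0P k).1.
by rewrite permM -(p0P _).2 -[p0 _](permE injp) permKV.
Qed.

(** * The tableau of a partition filled along its rows *)

Section Tableau.
Variable eta : {ffun 'I_m -> 'I_m.+1}.
Hypothesis part : is_partition eta.
Let sh := [seq val (eta i) | i <- enum 'I_m].

Lemma shape_nth (i : 'I_m) : nth 0%N sh i = eta i.
Proof. by rewrite (nth_map i) ?size_enum_ord // nth_ord_enum. Qed.

Lemma shape_sum : sumn sh = m.
Proof.
case/andP: part => _ /eqP sumE.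
by rewrite -[RHS]sumE sumnE big_map enumT.
Qed.

Lemma tabP k : exists2 i : 'I_m, tab_row eta k = i & (tab_col eta k < eta i)%N.
Proof.
have ltk : (k < sumn sh)%N by rewrite shape_sum.
have := reshape_indexP ltk; rewrite size_map size_enum_ord => ltr.
exists (Ordinal ltr) => //.
by have := reshape_offsetP ltk; rewrite -[reshape_index _ _]/(val (Ordinal ltr)) shape_nth.
Qed.

Lemma tab_inj k l :
  tab_row eta k = tab_row eta l -> tab_col eta k = tab_col eta l -> k = l.
Proof.
move=> er ec; apply/ord_inj.
by rewrite /= -[LHS](reshape_indexK sh) -[RHS](reshape_indexK sh) -/(tab_row _ _)
  -/(tab_col _ _) er ec.
Qed.

Lemma tab_ex (i : 'I_m) j : (j < eta i)%N ->
  exists k, tab_row eta k = i /\ tab_col eta k = j.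
Proof.
rewrite -shape_nth => ltj; have := flatten_indexP ltj; rewrite shape_sum => ltm.
exists (Ordinal ltm).
by rewrite /tab_row /tab_col /= flatten_indexKl ?flatten_indexKr.
Qed.

Lemma partition_mono (i j : 'I_m) : (i <= j)%N -> (eta j <= eta i)%N.
Proof.
by case/andP: part => /forallP/(_ i)/forallP/(_ j)/implyP.
Qed.

Lemma tab_diagram : diagram (tab_row eta) (tab_col eta).
Proof.
split=> [|k i j lei lej]; first exact: tab_inj.
have [i0 ri0 ltc] := tabP k; rewrite ri0 in lei.
have lti := leq_ltn_trans lei (ltn_ord i0).
apply: (@tab_ex (Ordinal lti)).
exact: leq_ltn_trans lej (leq_trans ltc (@partition_mono (Ordinal lti) i0 lei)).
Qed.

Lemma card_tab_row (i : 'I_m) : #|[set k | tab_row eta k == i]| = eta i.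
Proof.
have exk (j : 'I_(eta i)) := tab_ex (ltn_ord j).
have [h hP] := fin_all_exists exk.
have injh : injective h.
  by move=> j j' eqh; apply/ord_inj; rewrite -(hP j).2 -(hP j').2 eqh.
rewrite -[RHS]card_ord -(card_imset predT injh); apply: eq_card => k.
rewrite inE; apply/eqP/imsetP => [rk|[j _ ->]]; last exact: (hP j).1.
have [i0 ri0 ltc] := tabP k.
have ei : i0 = i by apply/ord_inj; rewrite -ri0 rk.
rewrite ei in ltc; exists (Ordinal ltc) => //.
by apply: tab_inj; rewrite ?(hP _).1 ?(hP _).2.
Qed.

End Tableau.

(** Each row length is the difference of two consecutive counts. *)
Lemma eq_partition eta nu : is_partition eta -> is_partition nu ->
  (forall j, #|[set k | tab_row eta k < j]| = #|[set k | tab_row nu k < j]|)%N ->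
  eta = nu.
Proof.
move=> peta pnu eqj; apply/ffunP => i; apply/ord_inj => /=.
rewrite -(card_tab_row peta) -(card_tab_row pnu).
have split_row mu : #|[set k | tab_row mu k == i]|
    = (#|[set k | (tab_row mu k < i.+1)%N]| - #|[set k | (tab_row mu k < i)%N]|)%N.
  rewrite -[X in (X - _)%N](cardsID [set k | (tab_row mu k < i)%N]).
  rewrite (_ : _ :&: _ = [set k | (tab_row mu k < i)%N]) ?addKn.
    by apply: eq_card => k; rewrite !inE -leqNgt ltnS -eqn_leq eq_sym.
  by apply/setP => k; rewrite !inE ltnS; case: ltngtP.
by rewrite !split_row !eqj.
Qed.

End Diagrams.

(** * Young symmetrizers *)

Section YoungSymmetrizers.
Variables (F : numFieldType) (m : nat).
Local Notation repr := (mx_representation F [set: 'S_m]%G).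
Implicit Types (eta nu : {ffun 'I_m -> 'I_m.+1}) (g x y p q : 'S_m).

Lemma rep_mul N (rG : repr N) x y : rG (x * y)%g = rG x *m rG y.
Proof. by rewrite repr_mxM ?inE. Qed.

Lemma rep_mulKV N (rG : repr N) x : rG x *m rG x^-1%g = 1%:M.
Proof. by rewrite -rep_mul mulgV repr_mx1. Qed.

Definition row_sum eta N (rG : repr N) := \sum_(p in row_stab eta) rG p.
Definition col_sum eta N (rG : repr N) :=
  \sum_(q in col_stab eta) (-1) ^+ (q : bool) *: rG q.
Fact ysym_key : unit. Proof. by []. Qed.
(* Locked, so that rewriting with [mulmxA] does not expose the two factors. *)
Definition ysym eta N (rG : repr N) :=
  locked_with ysym_key (row_sum eta rG *m col_sum eta rG).

Lemma ysym_unlock eta N (rG : repr N) :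
  ysym eta rG = row_sum eta rG *m col_sum eta rG.
Proof. by rewrite /ysym unlock. Qed.

Lemma row_stabP eta p :
  reflect (forall k, tab_row eta (p k) = tab_row eta k) (p \in row_stab eta).
Proof. by rewrite inE; apply: (iffP forallP) => pP k; apply/eqP. Qed.

Lemma col_stabP eta q :
  reflect (forall k, tab_col eta (q k) = tab_col eta k) (q \in col_stab eta).
Proof. by rewrite inE; apply: (iffP forallP) => qP k; apply/eqP. Qed.

Lemma row_stabM eta p p' : p \in row_stab eta ->
  ((p * p')%g \in row_stab eta) = (p' \in row_stab eta).
Proof.
move=> /row_stabP pP; apply/row_stabP/row_stabP => p'P k; last first.
  by rewrite permM p'P pP.
by rewrite -(permKV p k) -permM p'P pP.
Qed.

Lemma row_stabMr eta p p' : p \in row_stab eta ->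
  ((p' * p)%g \in row_stab eta) = (p' \in row_stab eta).
Proof.
move=> /row_stabP pP; apply/row_stabP/row_stabP => p'P k.
  by rewrite -(p'P k) permM pP.
by rewrite permM pP.
Qed.

Lemma col_stabM eta q q' : q \in col_stab eta ->
  ((q * q')%g \in col_stab eta) = (q' \in col_stab eta).
Proof.
move=> /col_stabP qP; apply/col_stabP/col_stabP => q'P k; last first.
  by rewrite permM q'P qP.
by rewrite -(permKV q k) -permM q'P qP.
Qed.

Lemma col_stabMr eta q q' : q \in col_stab eta ->
  ((q' * q)%g \in col_stab eta) = (q' \in col_stab eta).
Proof.
move=> /col_stabP qP; apply/col_stabP/col_stabP => q'P k.
  by rewrite -(q'P k) permM qP.
by rewrite permM qP.
Qed.

Lemma row_sumM eta N (rG : repr N) p : p \in row_stab eta ->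
  rG p *m row_sum eta rG = row_sum eta rG.
Proof.
move=> pP; rewrite /row_sum mulmx_sumr [RHS](reindex_inj (mulgI p)) /=.
by apply: eq_big => p'; [rewrite row_stabM | rewrite rep_mul].
Qed.

Lemma row_sumMr eta N (rG : repr N) p : p \in row_stab eta ->
  row_sum eta rG *m rG p = row_sum eta rG.
Proof.
move=> pP; rewrite /row_sum mulmx_suml [RHS](reindex_inj (mulIg p)) /=.
by apply: eq_big => p'; [rewrite row_stabMr | rewrite rep_mul].
Qed.

Lemma signK (b : bool) : (-1) ^+ b * (-1) ^+ b = 1 :> F.
Proof. by rewrite -signr_addb addbb. Qed.

Lemma col_sumM eta N (rG : repr N) q : q \in col_stab eta ->
  rG q *m col_sum eta rG = (-1) ^+ (q : bool) *: col_sum eta rG.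
Proof.
move=> qP; rewrite /col_sum mulmx_sumr [in RHS](reindex_inj (mulgI q)) /=.
rewrite scaler_sumr; apply: eq_big => q'; first by rewrite col_stabM.
by move=> _; rewrite -scalemxAr rep_mul odd_permM signr_addb scalerA mulrA signK mul1r.
Qed.

Lemma col_sumMr eta N (rG : repr N) q : q \in col_stab eta ->
  col_sum eta rG *m rG q = (-1) ^+ (q : bool) *: col_sum eta rG.
Proof.
move=> qP; rewrite /col_sum mulmx_suml [in RHS](reindex_inj (mulIg q)) /=.
rewrite scaler_sumr; apply: eq_big => q'; first by rewrite col_stabMr.
move=> _; rewrite -scalemxAl rep_mul odd_permM signr_addb scalerA.
by rewrite [_ * (_ * _)]mulrCA signK mulr1.
Qed.

Lemma eq_opp0 N (A : 'M[F]_N) : A = - A -> A = 0.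
Proof.
move=> eqA; apply/matrixP => i j; have := congr1 (fun B : 'M[F]_N => B i j) eqA.
by rewrite !mxE => /eqP; rewrite -addr_eq0 -mulr2n mulrn_eq0 /= => /eqP.
Qed.

(* A transposition of two entries of a row of [eta] that [g] moves into one
   column of [nu] changes the sign of the product without changing it. *)
Lemma row_col_sum0 eta nu N (rG : repr N) g k l : k != l ->
    tab_row eta k = tab_row eta l -> tab_col nu (g k) = tab_col nu (g l) ->
  row_sum eta rG *m rG g *m col_sum nu rG = 0.
Proof.
move=> neq_kl rkl ckl; apply: eq_opp0.
have tP : tperm k l \in row_stab eta.
  by apply/row_stabP => i; case: tpermP => // ->.
have tQ : (tperm k l ^ g)%g \in col_stab nu.
  by rewrite tpermJ; apply/col_stabP => i; case: tpermP => // ->.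
rewrite -{1}(row_sumMr rG tP) -(mulmxA _ _ (rG g)) -rep_mul conjgC rep_mul.
rewrite !mulmxA -(mulmxA _ _ (col_sum _ _)) (col_sumM rG tQ) odd_permJ odd_tperm.
by rewrite neq_kl expr1 scaleN1r mulmxN.
Qed.

Lemma col_row_sum0 eta nu N (rG : repr N) g k l : k != l ->
    tab_row nu k = tab_row nu l ->
    tab_col eta (g^-1%g k) = tab_col eta (g^-1%g l) ->
  col_sum eta rG *m rG g *m row_sum nu rG = 0.
Proof.
move=> neq_kl rkl ckl; apply: eq_opp0.
have tP : tperm k l \in row_stab nu.
  by apply/row_stabP => i; case: tpermP => // ->.
have tQ : (tperm k l ^ g^-1)%g \in col_stab eta.
  by rewrite tpermJ; apply/col_stabP => i; case: tpermP => // ->.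
rewrite -{1}(row_sumM rG tP) !mulmxA -(mulmxA _ (rG g)) -rep_mul.
rewrite (_ : g * _ = tperm k l ^ g^-1 * g)%g; last first.
  by rewrite conjgE invgK !mulgA mulgKV.
rewrite rep_mul !mulmxA (col_sumMr rG tQ) odd_permJ odd_tperm.
by rewrite neq_kl expr1 scaleN1r !mulNmx.
Qed.

Lemma row_col_sum_dominance eta nu N (rG : repr N) g :
    is_partition eta -> is_partition nu ->
    row_sum eta rG *m rG g *m col_sum nu rG != 0 ->
  forall j, (#|[set k | tab_row eta k < j]| <= #|[set k | tab_row nu k < j]|)%N.
Proof.
move=> peta pnu nz j.
apply: (row_dominance j (tab_diagram peta) (tab_diagram pnu) (@perm_inj _ g)).
move=> k l rkl ckl; apply/eqP; apply: contraNT nz => neq_kl.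
by rewrite (row_col_sum0 rG neq_kl rkl ckl).
Qed.

Lemma col_row_sum_dominance eta nu N (rG : repr N) g :
    is_partition eta -> is_partition nu ->
    col_sum eta rG *m rG g *m row_sum nu rG != 0 ->
  forall j, (#|[set k | tab_row nu k < j]| <= #|[set k | tab_row eta k < j]|)%N.
Proof.
move=> peta pnu nz j.
apply: (row_dominance j (tab_diagram pnu) (tab_diagram peta) (@perm_inj _ g^-1%g)).
move=> k l rkl ckl; apply/eqP; apply: contraNT nz => neq_kl.
by rewrite (col_row_sum0 rG neq_kl rkl ckl).
Qed.

Lemma col_row_sumE eta nu N (rG : repr N) x :
  col_sum eta rG *m rG x *m row_sum nu rG =
  \sum_(p in row_stab nu) \sum_(q in col_stab eta)
    (-1) ^+ (q : bool) *: rG (q * x * p)%g.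
Proof.
rewrite mulmx_sumr; apply: eq_bigr => p _; rewrite !mulmx_suml.
by apply: eq_bigr => q _; rewrite -!scalemxAl -!rep_mul.
Qed.

Lemma sandwich_sum N (A B : 'M[F]_N) (P Q : pred 'S_m) (a : 'S_m -> 'S_m -> F)
    (M : 'S_m -> 'S_m -> 'M[F]_N) :
  A *m (\sum_(p | P p) \sum_(q | Q q) a p q *: M p q) *m B =
  \sum_(p | P p) \sum_(q | Q q) a p q *: (A *m M p q *m B).
Proof.
rewrite mulmx_sumr mulmx_suml; apply: eq_bigr => p _.
rewrite mulmx_sumr mulmx_suml; apply: eq_bigr => q _.
by rewrite -scalemxAr -scalemxAl.
Qed.

(** A nonzero product forces dominance in both directions: one from the middle factor (column sum,
    [x], row sum), the other from some term row sum, [g], column sum in its expansion. The two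
    shapes then coincide. *)
Lemma ysym_orth eta nu N (rG : repr N) x :
    is_partition eta -> is_partition nu -> eta != nu ->
  ysym eta rG *m rG x *m ysym nu rG = 0.
Proof.
move=> peta pnu neq; apply/eqP; apply: contraTT (neq) => nz; rewrite negbK.
apply/eqP/(eq_partition peta pnu) => j; apply/eqP; rewrite eqn_leq.
have eqY : ysym eta rG *m rG x *m ysym nu rG
   = row_sum eta rG *m (col_sum eta rG *m rG x *m row_sum nu rG) *m col_sum nu rG.
  by rewrite !ysym_unlock !mulmxA.
apply/andP; split; last first.
  apply: (col_row_sum_dominance (rG := rG) (g := x)) => //.
  by apply: contraNneq nz => Y0; rewrite eqY Y0 mulmx0 mul0mx.
have [/existsP[g nzg]|/existsPn all0] := boolP [exists g,
  row_sum eta rG *m rG g *m col_sum nu rG != 0].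
  exact: row_col_sum_dominance nzg j.
case/eqP: nz; rewrite eqY col_row_sumE sandwich_sum big1 // => p _.
rewrite big1 // => q _.
by move: (all0 (q * x * p)%g); rewrite negbK => /eqP->; rewrite scaler0.
Qed.

(** The coefficient of [g] in the Young symmetrizer: the sign of [q] if [g = p q], and 0 if there is
    no such factorization. The factorization is unique, so the choice made by [pick] is
    immaterial. *)
Definition ycoef eta g : F :=
  if [pick q in col_stab eta | (g * q^-1)%g \in row_stab eta] is Some q
  then (-1) ^+ (q : bool) else 0.

(** If [g = p q], the row sum absorbs [p] and the column sum absorbs [q] up to sign. If [g] has no
    factorization, [diagram_factor] yields two entries of a row sent into one column, and
    [row_col_sum0] applies. *)
Lemma row_col_sum eta N (rG : repr N) g : is_partition eta ->
  row_sum eta rG *m rG g *m col_sum eta rG = ycoef eta g *: ysym eta rG.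
Proof.
move=> peta; rewrite /ycoef; case: pickP => [q /andP[qQ pP]|none].
  rewrite -{1}(mulgKV q g) rep_mul mulmxA (row_sumMr rG pP).
  by rewrite -mulmxA (col_sumM rG qQ) -scalemxAr ysym_unlock.
rewrite scale0r; apply/eqP; apply: contraT => nz.
have inj k l : tab_row eta k = tab_row eta l ->
    tab_col eta (g k) = tab_col eta (g l) -> k = l.
  move=> rkl ckl; apply/eqP; apply: contraNT nz => neq_kl.
  by rewrite (row_col_sum0 rG neq_kl rkl ckl).
have [p [q [pP qQ gE]]] := diagram_factor (tab_diagram peta) inj.
move: (none q); rewrite (introT (col_stabP _ _) qQ) gE mulgK.
by rewrite (introT (row_stabP _ _) pP).
Qed.

(** The scalar of [ysym_sandwich]. It is built from permutations alone, hence is the same in every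
    representation. *)
Definition ytheta eta x : F :=
  \sum_(p in row_stab eta) \sum_(q in col_stab eta)
    (-1) ^+ (q : bool) * ycoef eta (q * x * p)%g.

Lemma ysym_sandwich eta N (rG : repr N) x : is_partition eta ->
  ysym eta rG *m rG x *m ysym eta rG = ytheta eta x *: ysym eta rG.
Proof.
move=> peta.
have -> : ysym eta rG *m rG x *m ysym eta rG
   = row_sum eta rG *m (col_sum eta rG *m rG x *m row_sum eta rG) *m col_sum eta rG.
  by rewrite !ysym_unlock !mulmxA.
rewrite col_row_sumE sandwich_sum scaler_suml.
apply: eq_bigr => p _; rewrite scaler_suml.
by apply: eq_bigr => q _; rewrite row_col_sum // scalerA.
Qed.

(** By [sym_char1] this is m! / chi_eta(e). *)
Definition ykappa eta := ytheta eta 1%g.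

Lemma ysym_sqr eta N (rG : repr N) : is_partition eta ->
  ysym eta rG *m ysym eta rG = ykappa eta *: ysym eta rG.
Proof.
by move=> peta; rewrite -ysym_sandwich // repr_mx1 mulmx1.
Qed.

Lemma ysymE eta N (rG : repr N) : ysym eta rG =
  \sum_(p in row_stab eta) \sum_(q in col_stab eta)
    (-1) ^+ (q : bool) *: rG (p * q)%g.
Proof.
rewrite ysym_unlock mulmx_suml; apply: eq_bigr => p _.
by rewrite mulmx_sumr; apply: eq_bigr => q _; rewrite -scalemxAr rep_mul.
Qed.

Lemma mxtrace_reg x :
  \tr (regular_repr F [set: 'S_m]%G x) = (m`!)%:R *+ (x == 1%g).
Proof.
rewrite /mxtrace /= (eq_bigr (fun=> (x == 1%g)%:R)) => [|i _]; last first.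
  rewrite !mxE eqxx /= -(inj_eq (@enum_val_inj _ _)) /gring_index enum_rankK_in ?inE //.
  by rewrite -{1}(mulg1 (enum_val i)) (inj_eq (mulgI _)) eq_sym.
rewrite sumr_const card_ord (_ : gcard _ = m`!); last first.
  by rewrite /gcard /= cardsT card_Sn.
by case: (x == 1%g); rewrite ?mulr1n // mul0rn.
Qed.

End YoungSymmetrizers.

(** * Specht modules *)

Section SpechtCharacters.
Variables (F : numFieldType) (m : nat).
Local Notation repr := (mx_representation F [set: 'S_m]%G).
Local Notation reg := (regular_repr F [set: 'S_m]%G).
Implicit Types (g x : 'S_m).
Variable eta : {ffun 'I_m -> 'I_m.+1}.
Hypothesis peta : is_partition eta.
Local Notation kappa := (ykappa F eta).
Local Notation sgn q := ((-1) ^+ (q : bool) : F).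

Lemma stab_capE p : p \in row_stab eta -> p \in col_stab eta -> p = 1%g.
Proof.
move=> /row_stabP pP /col_stabP pQ; apply/permP => k.
by rewrite perm1; apply: (tab_inj (pP k) (pQ k)).
Qed.

(** Only the terms with [p q = 1] have a nonzero trace, and the row and column stabilizers meet
    trivially. *)
Lemma mxtrace_reg_ysym : \tr (ysym eta reg) = (m`!)%:R.
Proof.
rewrite ysymE mxtrace_sum /= (bigD1 1%g) /=; last by apply/row_stabP => k; rewrite perm1.
rewrite mxtrace_sum /= (bigD1 1%g) /=; last by apply/col_stabP => k; rewrite perm1.
rewrite mxtraceZ mxtrace_reg mulg1 eqxx odd_perm1 expr0 mul1r mulr1n.
rewrite big1 ?addr0 => [|q /andP[_ neq1]]; last first.
  by rewrite mxtraceZ mxtrace_reg mul1g (negPf neq1) mulr0.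
rewrite big1 ?addr0 // => p /andP[pP neq1]; rewrite mxtrace_sum big1 //= => q qQ.
rewrite mxtraceZ mxtrace_reg; case: eqP => [pq|]; rewrite ?mulr0 //.
have pE : p = (q^-1)%g by rewrite -[p](mulgK q) pq mul1g.
case/eqP: neq1; apply: stab_capE => //.
by rewrite -(col_stabMr _ qQ) pq; apply/col_stabP => k; rewrite perm1.
Qed.

Lemma fact_neq0 : (m`!)%:R != 0 :> F.
Proof. by rewrite pnatr_eq0 -lt0n fact_gt0. Qed.

(** The trace of the symmetrizer on the regular module, computed in two ways. It follows that kappa
    is nonzero. *)
Lemma ykappa_rank : kappa * (\rank (ysym eta reg))%:R = (m`!)%:R.
Proof.
by rewrite -(mxtrace_quasi_idem_rank (ysym_sqr reg peta)) mxtrace_reg_ysym.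
Qed.

Lemma ykappa_neq0 : kappa != 0.
Proof.
by apply: contraNneq fact_neq0 => k0; rewrite -ykappa_rank k0 mul0r.
Qed.

(** Summing over all conjugates makes this element central; divided by kappa^2 it is the central
    idempotent attached to [eta]. *)
Definition zsym N (rG : repr N) := \sum_g rG g^-1%g *m ysym eta rG *m rG g.

Lemma zsym_sandwich N (rG : repr N) (A B : 'M[F]_N) : A *m zsym rG *m B =
  \sum_g A *m rG g^-1%g *m ysym eta rG *m rG g *m B.
Proof.
rewrite /zsym mulmx_sumr mulmx_suml.
by apply: eq_bigr => g _; rewrite !mulmxA.
Qed.

Lemma zsym_comm N (rG : repr N) x : zsym rG *m rG x = rG x *m zsym rG.
Proof.
rewrite /zsym mulmx_suml mulmx_sumr [RHS](reindex_inj (mulIg x)) /=.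
apply: eq_bigr => g _; rewrite invMg !rep_mul !mulmxA.
by rewrite rep_mulKV mul1mx.
Qed.

Lemma comm_ysym N (rG : repr N) (X : 'M[F]_N) :
  (forall x, X *m rG x = rG x *m X) -> X *m ysym eta rG = ysym eta rG *m X.
Proof.
move=> Xc; rewrite ysymE mulmx_suml mulmx_sumr; apply: eq_bigr => p _.
rewrite mulmx_suml mulmx_sumr; apply: eq_bigr => q _.
by rewrite -scalemxAl -scalemxAr Xc.
Qed.

Lemma zsym_ysym_comm N (rG : repr N) : zsym rG *m ysym eta rG = ysym eta rG *m zsym rG.
Proof. exact: comm_ysym (zsym_comm rG). Qed.

(** Sandwiching twice shows that [zsym] acts on the symmetrizer Y by a scalar, found by comparing
    traces. *)
Lemma zsym_ysym N (rG : repr N) : zsym rG *m ysym eta rG = kappa ^+ 2 *: ysym eta rG.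
Proof.
pose s := \sum_g ytheta F eta g^-1%g * ytheta F eta g.
have zY M (sG : repr M) : zsym sG *m ysym eta sG = (s / kappa) *: ysym eta sG.
  apply: (scalerI ykappa_neq0); rewrite scalemxAr -ysym_sqr // mulmxA zsym_ysym_comm.
  rewrite scalerA mulrCA mulfV ?ykappa_neq0 // mulr1 zsym_sandwich.
  rewrite scaler_suml; apply: eq_bigr => g _.
  by rewrite ysym_sandwich // -!scalemxAl ysym_sandwich // scalerA.
suff <- : s / kappa = kappa ^+ 2 by exact: zY.
(* The scalar does not depend on the representation: read it off the trace of
   the regular one. *)
have sum_theta : \sum_(p in row_stab eta) \sum_(q in col_stab eta)
    sgn q * ytheta F eta (p * q)%g = kappa ^+ 2.
  have : (\sum_(p in row_stab eta) \sum_(q in col_stab eta)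
      sgn q * ytheta F eta (p * q)%g) *: ysym eta reg = kappa ^+ 2 *: ysym eta reg.
    rewrite expr2 -scalerA -(ysym_sqr reg peta) [in RHS]scalemxAr -(ysym_sqr reg peta) mulmxA.
    rewrite [X in _ = _ *m X *m _]ysymE sandwich_sum scaler_suml; apply: eq_bigr => p _.
    by rewrite scaler_suml; apply: eq_bigr => q _; rewrite ysym_sandwich // scalerA.
  move/(congr1 mxtrace); rewrite !mxtraceZ mxtrace_reg_ysym.
  exact: (mulIf fact_neq0).
apply: (mulIf fact_neq0); rewrite -mxtrace_reg_ysym -mxtraceZ -zY.
rewrite -sum_theta !mxtrace_reg_ysym /zsym mulmx_suml mxtrace_sum.
(* The regular trace of g^-1 Y picks out the products [p q] equal to [g], so the total is m! times
   the sum evaluated in [sum_theta]. *)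
transitivity (\sum_g ytheta F eta g * \tr (reg g^-1%g *m ysym eta reg)).
  by apply: eq_bigr => g _; rewrite -!mulmxA [ysym _ _ *m _]mulmxA ysym_sandwich //
    -scalemxAr mxtraceZ.
transitivity (\sum_g \sum_(p in row_stab eta) \sum_(q in col_stab eta)
    (sgn q * ytheta F eta g * (m`!)%:R) *+ (g == p * q)%g).
  apply: eq_bigr => g _; rewrite ysymE !mulmx_sumr mxtrace_sum mulr_sumr /=.
  apply: eq_bigr => p _; rewrite mulmx_sumr mxtrace_sum mulr_sumr /=.
  apply: eq_bigr => q _; rewrite -scalemxAr mxtraceZ -rep_mul mxtrace_reg.
  rewrite (_ : (g^-1 * (p * q) == 1)%g = (g == p * q)%g).
    by case: eqP; rewrite ?mulr0n ?mulr0 // !mulr1n mulrCA mulrA.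
  by rewrite -(inj_eq (mulgI g)) mulKVg mulg1 eq_sym.
rewrite exchange_big mulr_suml; apply: eq_bigr => p _.
rewrite exchange_big mulr_suml; apply: eq_bigr => q _.
by rewrite (bigD1 (p * q)%g) //= eqxx mulr1n big1 ?addr0 // => g /negPf->.
Qed.

Lemma zsym_sqr N (rG : repr N) : zsym rG *m zsym rG = kappa ^+ 2 *: zsym rG.
Proof.
rewrite {2}/zsym mulmx_sumr scaler_sumr; apply: eq_bigr => g _.
by rewrite !mulmxA zsym_comm -(mulmxA _ (zsym _)) zsym_ysym -scalemxAr -scalemxAl.
Qed.

Lemma mxtrace_zsym N (rG : repr N) : \tr (zsym rG) = (m`!)%:R * \tr (ysym eta rG).
Proof.
rewrite /zsym mxtrace_sum /= (eq_bigr (fun=> \tr (ysym eta rG))) => [|g _].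
  by rewrite sumr_const mulr_natl -[in RHS]card_Sn.
by rewrite -mulmxA mxtrace_mulC -mulmxA rep_mulKV mulmx1.
Qed.

Definition zcoef x : F :=
  \sum_g \sum_(p in row_stab eta) \sum_(q in col_stab eta)
    sgn q *+ (g^-1 * (p * q) * g == x)%g.

Lemma zsymE N (rG : repr N) : zsym rG = \sum_x zcoef x *: rG x.
Proof.
rewrite /zcoef; under [RHS]eq_bigr do rewrite scaler_suml.
rewrite exchange_big; apply: eq_bigr => g _.
under [RHS]eq_bigr do rewrite scaler_suml.
rewrite exchange_big ysymE sandwich_sum; apply: eq_bigr => p _.
under [RHS]eq_bigr do rewrite scaler_suml.
rewrite exchange_big; apply: eq_bigr => q _.
rewrite (bigD1 (g^-1 * (p * q) * g)%g) //= eqxx mulr1n big1 ?addr0 => [|x].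
  by rewrite !rep_mul.
by rewrite eq_sym => /negPf->; rewrite mulr0n scale0r.
Qed.

(** The row [u] lists the coordinates of the Young symmetrizer, and [L] is left multiplication by it
    on the group algebra. Hence [L] commutes with the right multiplications [reg], and its row space
    is the Specht module. *)
Let u := gring_row (ysym eta reg).
Let L := \matrix_(i < #|[set: 'S_m]%G|) (u *m reg (enum_val i)).

Let row_L g : row (gring_index [set: 'S_m]%G g) L = u *m reg g.
Proof. by rewrite rowK gring_indexK ?inE. Qed.

Let L_comm x : reg x *m L = L *m reg x.
Proof.
apply/row_matrixP => i; rewrite !row_mul rowK -rowE row_L rowK.
by rewrite rep_mul mulmxA.
Qed.

Let L_sqr : L *m L = kappa *: L.
Proof.
have uL : u *m L = kappa *: u.
  have -> : u *m L = gring_row (ysym eta reg *m L) by rewrite -gring_row_mul.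
  have -> : ysym eta reg *m L = L *m ysym eta reg.
    by rewrite (comm_ysym (rG := reg)).
  rewrite gring_row_mul {1}/gring_row row_L repr_mx1 mulmx1 -gring_row_mul.
  by rewrite ysym_sqr // linearZ.
apply/row_matrixP => i; rewrite row_mul linearZ /= !rowK.
by rewrite -mulmxA L_comm mulmxA uL -scalemxAl.
Qed.

Let specht_L : (specht_mod eta F :=: L)%MS.
Proof.
have uE : gring_row (young_symmetrizer eta F) = u by rewrite /u ysym_unlock.
apply/eqmxP/andP; split.
  apply/row_subP => i; have /cyclic_mxP[A + ->] := row_sub i (specht_mod eta F).
  case/envelop_mxP=> a ->; rewrite uE.
  rewrite mulmx_sumr summx_sub // => x _.
  by rewrite -scalemxAr scalemx_sub // -row_L row_sub.
apply/row_subP => i; rewrite rowK -uE; apply/cyclic_mxP.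
by exists (reg (enum_val i)); rewrite ?envelop_mx_id ?inE.
Qed.

(** Since [L] is quasi-idempotent with the Specht module as row space, kappa chi(x) is the trace of
    [L *m reg x]. Its diagonal entry at [g] sums the signs of the pairs with p q g x = g, that is,
    g^-1 p q g = x^-1. *)
Lemma sym_char_zcoef x : kappa * sym_char eta F x = zcoef x^-1%g.
Proof.
rewrite /sym_char -(@mxtrace_quasi_idem _ _ _ (reg x) _ _
  (val_submod (U := specht_mod eta F) 1%:M) _ L_sqr).
- rewrite /mxtrace /zcoef (reindex (gring_index [set: 'S_m]%G)) /=; last first.
    by exists enum_val => y _; rewrite ?gring_indexK ?inE // gring_valK.
  apply: eq_bigr => g _.
  have -> : (L *m reg x) (gring_index [set: 'S_m]%G g) (gring_index [set: 'S_m]%G g)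
      = gring_row (ysym eta reg *m reg (g * x)%g) 0 (gring_index [set: 'S_m]%G g).
    have <- : row (gring_index [set: 'S_m]%G g) (L *m reg x)
        = gring_row (ysym eta reg *m reg (g * x)%g).
      by rewrite row_mul row_L gring_row_mul rep_mul mulmxA.
    by rewrite [RHS]mxE.
  rewrite ysymE mulmx_suml linear_sum summxE; apply: eq_bigr => p _.
  rewrite mulmx_suml linear_sum summxE; apply: eq_bigr => q _.
  rewrite -scalemxAl -rep_mul linearZ /= /gring_row rowK !mxE eqxx /=.
  rewrite gring_indexK ?inE // mul1g (can_in_eq (@gring_indexK _ [set: 'S_m]%G)) ?inE //.
  rewrite mulr_natr; congr (_ *+ nat_of_bool _); apply/eqP/eqP => E.
    by apply: (mulIg x); rewrite mulVg -mulgA -mulgA -E mulVg.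
  by apply: (mulgI g^-1%g); rewrite mulVg !mulgA; rewrite !mulgA in E; rewrite E mulVg.
- by rewrite /row_free val_submod1.
- exact: eqmx_trans (val_submod1 _) specht_L.
have := val_submodJ (cyclic_mx_module reg (gring_row (young_symmetrizer eta F)))
  1%:M (finset.in_setT x).
by rewrite mul1mx => <-; rewrite -val_submodE.
Qed.

(** The coefficient of the identity in [zsym] is its regular trace divided by m!, and that trace is
    m! times m!. *)
Lemma sym_char1 : kappa * sym_char eta F 1%g = (m`!)%:R.
Proof.
rewrite sym_char_zcoef invg1; apply: (mulIf fact_neq0).
have := mxtrace_zsym reg; rewrite mxtrace_reg_ysym => <-.
rewrite zsymE mxtrace_sum (bigD1 1%g) //= big1 ?addr0 => [|x neq1].
  by rewrite mxtraceZ mxtrace_reg eqxx mulr1n.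
by rewrite mxtraceZ mxtrace_reg (negPf neq1) mulr0.
Qed.

End SpechtCharacters.

Lemma zsym_orth (F : numFieldType) m (eta nu : {ffun 'I_m -> 'I_m.+1}) N
    (rG : mx_representation F [set: 'S_m]%G N) :
    is_partition eta -> is_partition nu -> eta != nu ->
  zsym eta rG *m zsym nu rG = 0.
Proof.
move=> peta pnu neq; rewrite {1}/zsym mulmx_suml big1 // => g _.
rewrite /zsym mulmx_sumr big1 // => h _.
rewrite -!mulmxA (mulmxA (rG g)) -rep_mul (mulmxA (ysym eta rG)).
by rewrite (mulmxA _ (ysym nu rG)) ysym_orth // mul0mx mulmx0.
Qed.

(** * Counting tableaux *)

Section TableauCount.
Variable m : nat.
Local Notation shape := {ffun 'I_m -> 'I_m.+1}.
Implicit Types (eta nu ka : shape) (i : 'I_m).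

(** Row lengths continued by 0 beyond row [m], so that [j.+1] needs no boundary case. *)
Definition row_len eta j : nat := nth 0%N [seq val (eta i) | i <- enum 'I_m] j.

Lemma row_lenE eta i : row_len eta i = eta i.
Proof. exact: shape_nth. Qed.

Lemma row_len_out eta j : (m <= j)%N -> row_len eta j = 0%N.
Proof. by move=> lemj; rewrite /row_len nth_default // size_map size_enum_ord. Qed.

Lemma shape_eqP eta nu : (forall j, row_len eta j = row_len nu j) -> eta = nu.
Proof. by move=> E; apply/ffunP => i; apply/ord_inj; rewrite -!row_lenE E. Qed.

Definition decreasing eta := [forall i : 'I_m, (row_len eta i.+1 <= eta i)%N].

(* [eta] is obtained from [nu] by adding a horizontal strip. *)
Definition interlace nu eta :=
  [forall i : 'I_m, (row_len eta i.+1 <= nu i)%N && (nu i <= eta i)%N].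

Lemma decreasingP eta :
  reflect (forall j, row_len eta j.+1 <= row_len eta j)%N (decreasing eta).
Proof.
apply: (iffP forallP) => [dec j|dec i]; last by rewrite -row_lenE.
have [ltjm|lemj] := ltnP j m; last by rewrite !row_len_out // ltnW.
by have := dec (Ordinal ltjm); rewrite -row_lenE.
Qed.

Lemma interlaceP nu eta :
  reflect (forall j, row_len eta j.+1 <= row_len nu j <= row_len eta j)%N
    (interlace nu eta).
Proof.
apply: (iffP forallP) => [int j|int i]; last by rewrite -!row_lenE.
have [ltjm|lemj] := ltnP j m; last by rewrite !row_len_out // ltnW.
by have := int (Ordinal ltjm); rewrite -!row_lenE.
Qed.

(** Since row lengths live in ['I_m.+1], [inord] gives the intended value only if [nu i < m]. *)
Definition add_box nu i : shape :=
  [ffun k => if k == i then inord (nu k).+1 else nu k].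
Definition del_box nu i : shape :=
  [ffun k => if k == i then inord (nu k).-1 else nu k].

Lemma row_len_add nu i j : (nu i < m)%N ->
  row_len (add_box nu i) j = (row_len nu j + (j == i))%N.
Proof.
move=> lt; have [ltjm|lemj] := ltnP j m; last first.
  by rewrite !row_len_out // gtn_eqF // (leq_trans (ltn_ord i)).
rewrite -[j]/(nat_of_ord (Ordinal ltjm)) !row_lenE ffunE -val_eqE /=.
have [eji|] := eqVneq j i; last by rewrite addn0.
have -> : Ordinal ltjm = i by apply/ord_inj.
by rewrite inordK // addn1.
Qed.

Lemma row_len_del nu i j : row_len (del_box nu i) j = (row_len nu j - (j == i))%N.
Proof.
have [ltjm|lemj] := ltnP j m; last first.
  by rewrite !row_len_out.
rewrite -[j]/(nat_of_ord (Ordinal ltjm)) !row_lenE ffunE -val_eqE /=.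
have [eji|] := eqVneq j i; last by rewrite subn0.
rewrite inordK ?subn1 // (leq_ltn_trans (leq_pred _)) //.
Qed.

Lemma add_boxK nu i : (nu i < m)%N -> del_box (add_box nu i) i = nu.
Proof.
move=> lt; apply: shape_eqP => j; rewrite row_len_del row_len_add //.
by rewrite addnK.
Qed.

Lemma del_boxK nu i : (0 < nu i)%N -> add_box (del_box nu i) i = nu.
Proof.
move=> lt; have ltd : (del_box nu i i < m)%N.
  rewrite -row_lenE row_len_del eqxx row_lenE subn1.
  by rewrite -ltnS prednK // ltn_ord.
apply: shape_eqP => j; rewrite row_len_add // row_len_del.
have [->|] := eqVneq j i; last by rewrite subn0 addn0.
by rewrite row_lenE subnK.
Qed.

Definition size_shape eta := (\sum_(i < m) eta i)%N.

Lemma size_add_box nu i : (nu i < m)%N -> size_shape (add_box nu i) = (size_shape nu).+1.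
Proof.
move=> lt; rewrite /size_shape (bigD1 i) //= [in RHS](bigD1 i) //=.
rewrite ffunE eqxx inordK // addSn; congr (_ + _).+1.
by apply: eq_bigr => k /negPf neq; rewrite ffunE neq.
Qed.

Lemma row_len_size eta i : (eta i <= size_shape eta)%N.
Proof. by rewrite /size_shape (bigD1 i) //= leq_addr. Qed.

(** A nonempty row of index at least m - 1 would make all [m] rows nonempty. *)
Lemma last_row0 eta j : decreasing eta -> (size_shape eta < m)%N -> (m.-1 <= j)%N ->
  row_len eta j = 0%N.
Proof.
move=> /decreasingP dec small lej; have [ltjm|/row_len_out//] := ltnP j m.
apply/eqP; rewrite -leqn0 leqNgt; apply/negP => pos.
suff : (m <= size_shape eta)%N by rewrite leqNgt small.
rewrite -[X in (X <= _)%N]card_ord -sum1_card; apply: leq_sum => i _.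
have lei : (i <= j)%N by have := ltn_ord i; lia.
rewrite -row_lenE; apply: (leq_trans pos).
elim: j lei {pos ltjm lej} => [|j IH]; first by rewrite leqn0 => /eqP->.
by rewrite leq_eqVlt ltnS => /orP[/eqP->//|/IH]; apply: leq_trans (dec j).
Qed.

(* The cells holding the largest letter form a horizontal strip. *)
Fixpoint num_ssyt n eta : nat :=
  if n is n'.+1 then (\sum_(nu | interlace nu eta) num_ssyt n' nu)%N
  else (eta == [ffun=> ord0]).

(** Counts standard tableaux with [k] cells: the largest entry sits in a removable corner. *)
Fixpoint num_syt k eta : nat :=
  if k is k'.+1
  then (\sum_(i | (0 < eta i)%N && decreasing (del_box eta i)) num_syt k' (del_box eta i))%N
  else (eta == [ffun=> ord0]).

Lemma interlace_decreasing nu eta :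
  interlace nu eta -> decreasing eta -> decreasing nu.
Proof.
move=> /interlaceP int /decreasingP dec; apply/decreasingP => j.
by have := int j; have := int j.+1; lia.
Qed.

Lemma interlace_size nu eta : interlace nu eta -> (size_shape nu <= size_shape eta)%N.
Proof.
by move=> /forallP int; apply: leq_sum => i _; case/andP: (int i).
Qed.

(** Row 0 accounts for the summand 1, the other rows are shifted by one, and the last term on the
    right vanishes because [g N.-1 = 0]. *)
Lemma sum_shift (N : nat) (f g : nat -> nat) : (0 < N)%N -> g N.-1 = 0%N ->
  (\sum_(i < N | (nat_of_ord i == 0) || (f i < g i.-1)) 1
   = 1 + \sum_(i < N | f i.+1 < g i) 1)%N.
Proof.
case: N => // N _ /= gN; rewrite big_mkcond [in RHS]big_mkcond big_ord_recl /=.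
by rewrite [in RHS]big_ord_recr /= gN ltn0 addn0.
Qed.

(* Both sides count the ways to pass from [nu] to [ka] by adding a box and
   removing a horizontal strip, in either order. *)
Lemma box_strip_exchange nu ka : decreasing nu -> (size_shape nu < m)%N ->
  (\sum_(i | [&& (nu i < m)%N, decreasing (add_box nu i) & interlace ka (add_box nu i)]) 1
  = interlace ka nu
    + \sum_(i | [&& (0 < ka i)%N, decreasing ka & interlace (del_box ka i) nu]) 1)%N.
Proof.
move=> dnu small.
have nuP := elimT (decreasingP nu) dnu.
have ltm i : (nu i < m)%N := leq_ltn_trans (row_len_size nu i) small.
have m_gt0 : (0 < m)%N by apply: leq_ltn_trans small.
(* If [ka] does not interlace [nu], then on either side row [i] of [ka] must be one longer than that
   of [nu], and the two index sets agree. *)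
have [int|nint] := boolP (interlace ka nu); last first.
  rewrite add0n; apply: eq_bigl => i; rewrite ltm /=.
  apply/andP/and3P => [[/decreasingP d1 /interlaceP int1]|[pos /decreasingP d1 /interlaceP int1]].
    have kai : row_len ka i = (row_len nu i).+1.
      apply/eqP; apply: contraNT nint => neq; apply/interlaceP => j.
      have := int1 j; rewrite !row_len_add // => /andP[].
      case: (eqVneq j i) => [->|]; last by lia.
      by move/eqP: neq; lia.
    split; first by rewrite -row_lenE kai.
      apply: interlace_decreasing (introT (interlaceP _ _) int1) _.
      exact/decreasingP.
    apply/interlaceP => j; rewrite row_len_del; have := int1 j.
    rewrite !row_len_add //; case: (eqVneq j i) => [->|]; last by lia.
    by rewrite kai; have := nuP i; lia.
  have kai : row_len ka i = (row_len nu i).+1.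
    apply/eqP; apply: contraNT nint => neq; apply/interlaceP => j.
    have := int1 j; rewrite row_len_del.
    case: (eqVneq j i) => [->|]; last by lia.
    by move/eqP: neq; lia.
  have int2 : interlace ka (add_box nu i).
    apply/interlaceP => j; have := int1 j; rewrite row_len_del !row_len_add //.
    case: (eqVneq j i) => [->|_]; first by rewrite kai; have := nuP i; lia.
    by case: eqVneq => [eji|]; have := d1 j; [rewrite eji kai|]; lia.
  split=> //; apply/decreasingP => j; rewrite !row_len_add //.
  have := nuP j; case: (eqVneq j.+1 i) => [eji _|]; last by lia.
  by have := int1 j; rewrite row_len_del eji; have := d1 j; rewrite eji kai; lia.
have dka := interlace_decreasing int dnu.
move/interlaceP in int.
(* If [ka] interlaces [nu], a box can be added in row 0 or where [nu i < ka (i - 1)], and removed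
   where [nu (i + 1) < ka i]; the shift by one row leaves one extra choice. *)
rewrite (eq_bigl (fun i : 'I_m => (nat_of_ord i == 0) || (row_len nu i < row_len ka i.-1))%N); last first.
  move=> i; rewrite ltm /=; apply/andP/idP => [[/decreasingP d1 /interlaceP int1]|].
    case: (nat_of_ord i) int1 (fun j => @row_len_add nu i j (ltm i)) => //= j int1 addE.
    by have := int1 j; rewrite !addE eqxx; lia.
  move=> cond; split; [apply/decreasingP => j|apply/interlaceP => j];
    rewrite !row_len_add //; have := int j; have := nuP j;
    move: cond; case: (eqVneq j.+1 i) => [<-|_] /=; lia.
rewrite [in RHS](eq_bigl (fun i : 'I_m => (row_len nu i.+1 < row_len ka i)%N)); last first.
  move=> i; apply/and3P/idP => [[pos _ /interlaceP int1]|lt].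
    by have := int1 i; rewrite row_len_del eqxx row_lenE; lia.
  split=> //; first by rewrite -row_lenE; lia.
  apply/interlaceP => j; rewrite row_len_del; have := int j.
  by case: (eqVneq j i) => [->|]; lia.
rewrite -[RHS]/(1 + _)%N; apply: sum_shift => //.
by have := int m.-1; rewrite (last_row0 dnu small (leqnn _)); lia.
Qed.

Lemma size_shape0 : size_shape [ffun=> ord0] = 0%N.
Proof. by rewrite /size_shape big1 // => i _; rewrite ffunE. Qed.

Lemma row_len0 j : row_len [ffun=> ord0] j = 0%N.
Proof.
have [ltjm|/row_len_out//] := ltnP j m.
by rewrite -[j]/(nat_of_ord (Ordinal ltjm)) row_lenE ffunE.
Qed.

(** Induction on [n]: removing the strip of the largest letter and exchanging it with the added box
    gives [num_ssyt n.+1 nu] once, plus the same sum for each shape interlacing [nu] with one letter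
    less. *)
Lemma pieri n nu : decreasing nu -> (size_shape nu < m)%N ->
  (\sum_(i | (nu i < m)%N && decreasing (add_box nu i)) num_ssyt n (add_box nu i)
   = n * num_ssyt n nu)%N.
Proof.
elim: n nu => [|n IHn] nu dnu small.
  rewrite mul0n big1 // => i /andP[lt _] /=; case: eqP => // /(congr1 size_shape).
  by rewrite size_add_box // size_shape0.
transitivity (\sum_ka num_ssyt n ka * \sum_(i | [&& (nu i < m)%N,
    decreasing (add_box nu i) & interlace ka (add_box nu i)]) 1)%N.
  rewrite /= (exchange_big_dep predT) //=; apply: eq_bigr => ka _.
  by rewrite big_distrr /=; apply: eq_big => i; rewrite ?andbA ?muln1.
under eq_bigr do rewrite (box_strip_exchange _ dnu small) mulnDr.
rewrite big_split /= mulSn; congr (_ + _)%N.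
  rewrite [RHS]big_mkcond; apply: eq_bigr => ka _.
  by case: ifP; rewrite ?muln1 ?muln0.
rewrite big_distrr /=.
transitivity (\sum_(ka | interlace ka nu)
    \sum_(i | (ka i < m)%N && decreasing (add_box ka i)) num_ssyt n (add_box ka i))%N.
  under eq_bigr do rewrite big_distrr /=.
  rewrite (exchange_big_dep predT) //= [RHS](exchange_big_dep predT) //=.
  apply: eq_bigr => i _.
  rewrite (reindex_onto (add_box^~ i) (del_box^~ i)) /=; last first.
    by move=> ka /andP[pos _]; apply: del_boxK.
  apply: eq_big => [ka|ka _]; last by rewrite muln1.
  apply/andP/and3P => [[/and3P[pos dec int] /eqP addK]|[int lt dec]].
    by rewrite addK in int; split=> //; rewrite -{1}addK
      -row_lenE row_len_del row_lenE eqxx subn1 -ltnS prednK // ltn_ord.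
  rewrite add_boxK // dec int eqxx !andbT; split=> //.
  by rewrite -row_lenE row_len_add // eqxx addn1.
apply: eq_bigr => ka int; apply: IHn; first exact: interlace_decreasing int dnu.
exact: leq_ltn_trans (interlace_size int) small.
Qed.

(** Induction on [k]: pairs of a shape and a removable box correspond to pairs of a smaller shape
    and an addable box, and [pieri] supplies the factor [n]. The bound on [k] keeps all shapes
    inside the encoding. *)
Lemma sum_syt_ssyt n k : (k <= m)%N ->
  (\sum_(eta | decreasing eta && (size_shape eta == k)) num_syt k eta * num_ssyt n eta
   = n ^ k)%N.
Proof.
elim: k => [|k IHk] lekm.
  rewrite (bigD1 [ffun=> ord0]) /=; last first.
    rewrite size_shape0 eqxx andbT; apply/forallP => i.
    by rewrite row_len0.
  rewrite eqxx mul1n big1 ?addn0 => [|eta /andP[_ /negPf->]] //.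
  elim: n => [|n IHn] /=; first by rewrite eqxx.
  rewrite (bigD1 [ffun=> ord0]) /=; last first.
    by apply/interlaceP => j; rewrite !row_len0.
  rewrite IHn big1 // => nu /andP[/forallP int /eqP []].
  by apply/ffunP => i; have /andP[_] := int i; rewrite !ffunE leqn0 => /eqP ?; apply/ord_inj.
rewrite expnS -(IHk (ltnW lekm)) big_distrr /=.
transitivity (\sum_(eta | decreasing eta && (size_shape eta == k))
   \sum_(i | (eta i < m)%N && decreasing (add_box eta i))
      num_syt k eta * num_ssyt n (add_box eta i))%N; last first.
  apply: eq_bigr => eta /andP[dec /eqP sz].
  by rewrite -big_distrr /= pieri ?sz // mulnCA.
under eq_bigr do rewrite big_distrl /=.
rewrite (exchange_big_dep predT) //= [RHS](exchange_big_dep predT) //=.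
apply: eq_bigr => i _.
rewrite (reindex_onto (add_box^~ i) (del_box^~ i)) /=; last first.
  by move=> eta /andP[_ /andP[pos _]]; apply: del_boxK.
apply: eq_big => [eta|eta /andP[_ /eqP->]] //.
apply/andP/andP => [[/andP[/andP[dec /eqP sz] /andP[pos decd]] /eqP addK]|].
  have lt : (eta i < m)%N.
    by rewrite -addK -row_lenE row_len_del row_lenE eqxx subn1 -ltnS prednK // ltn_ord.
  rewrite addK in decd; move: sz; rewrite size_add_box // => -[<-].
  by rewrite decd eqxx lt dec.
move=> [/andP[dec /eqP sz] /andP[lt deca]].
rewrite add_boxK // deca dec size_add_box // sz !eqxx.
by rewrite -row_lenE row_len_add // eqxx addn1.
Qed.

End TableauCount.

(** * Tableaux built up by their largest letter *)

Section TableauExtension.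
Variable m : nat.
Local Notation shape := {ffun 'I_m -> 'I_m.+1}.
Implicit Types (eta nu : shape).

Definition ext_tab n nu eta (T : {ffun cell nu -> 'I_n}) : {ffun cell eta -> 'I_n.+1} :=
  [ffun c => if insub (val c) is Some c' then widen_ord (leqnSn n) (T c')
             else ord_max].

Definition diag_set nu : {set 'I_m * 'I_m} := [set x : 'I_m * 'I_m | (x.2 < nu x.1)%N].

(** The cells not holding the largest letter; they recover [nu] from an extended tableau. *)
Definition old_cells n eta (T : {ffun cell eta -> 'I_n.+1}) : {set 'I_m * 'I_m} :=
  [set x : 'I_m * 'I_m | [exists c, (val c == x) && (T c < n)%N]].

Lemma ext_tabE n nu eta (T : {ffun cell nu -> 'I_n}) (c : cell eta) (c' : cell nu) :
  val c = val c' -> ext_tab eta T c = T c' :> nat.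
Proof. by move=> E; rewrite ffunE E valK. Qed.

Lemma ext_tab_new n nu eta (T : {ffun cell nu -> 'I_n}) (c : cell eta) :
  (nu (val c).1 <= (val c).2)%N -> ext_tab eta T c = n :> nat.
Proof. by move=> le; rewrite ffunE insubN // -leqNgt. Qed.

Lemma interlace_le nu eta (i : 'I_m) : interlace nu eta -> (nu i <= eta i)%N.
Proof. by move=> /forallP/(_ i)/andP[]. Qed.

Lemma ext_tab_inj n nu eta : interlace nu eta -> injective (@ext_tab n nu eta).
Proof.
move=> int T T' eqT; apply/ffunP => c'; apply/ord_inj.
have ltc : ((val c').2 < eta (val c').1)%N.
  exact: leq_trans (valP c') (interlace_le _ int).
pose c : cell eta := exist _ (val c') ltc.
by rewrite -(@ext_tabE n nu eta T c c') // eqT (@ext_tabE n nu eta T' c c').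
Qed.

Lemma old_cells_ext n nu eta (T : {ffun cell nu -> 'I_n}) : interlace nu eta ->
  old_cells (ext_tab eta T) = diag_set nu.
Proof.
move=> int; apply/setP => x; rewrite !inE; apply/existsP/idP => [[c /andP[/eqP <-]]|ltx].
  by rewrite (ltnNge (val c).2); apply: contraTN => /(ext_tab_new T) ->; rewrite ltnn.
have ltc : (x.2 < eta x.1)%N by apply: leq_trans ltx (interlace_le _ int).
pose c : cell eta := exist _ x ltc; pose c' : cell nu := exist _ x ltx.
by exists c; rewrite eqxx (@ext_tabE n nu eta T c c') //= ltn_ord.
Qed.

Lemma diag_set_inj : injective diag_set.
Proof.
have le nu nu' i : diag_set nu = diag_set nu' -> (nu i <= nu' i)%N.
  move=> /setP E; rewrite leqNgt; apply/negP => lt.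
  have ltm : (nu' i < m)%N by rewrite (leq_trans lt) // -ltnS ltn_ord.
  by have := E (i, Ordinal ltm); rewrite !inE /= lt ltnn.
move=> nu nu' E; apply/ffunP => i; apply/ord_inj/eqP.
by rewrite eqn_leq !le.
Qed.

(** By interlacing, any cell strictly above another cell of [eta] lies in [nu], so the new letter
    occurs at most once in a column. *)
Lemma ext_tab_semistandard n nu eta (T : {ffun cell nu -> 'I_n}) :
  interlace nu eta -> decreasing eta -> semistandard T -> semistandard (ext_tab eta T).
Proof.
move=> int dec /forallP ssT; apply/forallP => c; apply/forallP => d.
have int' := elimT (interlaceP _ _) int.
have dnu := elimT (decreasingP _) (interlace_decreasing int dec).
have mono (f : nat -> nat) a b : (forall j, f j.+1 <= f j)%N -> (a <= b)%N -> (f b <= f a)%N.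
  move=> fS; elim: b => [|b IH]; first by rewrite leqn0 => /eqP->.
  by rewrite leq_eqVlt ltnS => /orP[/eqP->//|/IH]; apply: leq_trans.
have [ltd|led] := ltnP (val d).2 (nu (val d).1); last first.
  have dE := ext_tab_new T led; apply/andP; split; apply/implyP => /andP[/eqP eq1 lt2].
    by rewrite dE -ltnS ltn_ord.
  have ltc : ((val c).2 < nu (val c).1)%N.
    rewrite eq1 (leq_trans (valP d)) // -!row_lenE.
    have /andP[+ _] := int' (val c).1; apply: leq_trans.
    by apply: mono lt2; apply/decreasingP.
  pose c' : cell nu := exist _ (val c) ltc.
  by rewrite dE (@ext_tabE n nu eta T c c').
pose d' : cell nu := exist _ (val d) ltd.
apply/andP; split; apply/implyP => /andP[/eqP eq1 le2].
  have ltc : ((val c).2 < nu (val c).1)%N by rewrite eq1 (leq_ltn_trans le2).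
  pose c' : cell nu := exist _ (val c) ltc.
  rewrite (@ext_tabE n nu eta T c c') // (@ext_tabE n nu eta T d d') //.
  by have /forallP/(_ d')/andP[/implyP + _] := ssT c'; apply; rewrite /= eq1 eqxx.
have ltc : ((val c).2 < nu (val c).1)%N.
  by rewrite eq1 (leq_trans ltd) // -!row_lenE mono // ltnW.
pose c' : cell nu := exist _ (val c) ltc.
rewrite (@ext_tabE n nu eta T c c') // (@ext_tabE n nu eta T d d') //.
by have /forallP/(_ d')/andP[_ /implyP] := ssT c'; apply; rewrite /= eq1 eqxx.
Qed.

(** Extension is injective for each [i], and the images for different [i] are disjoint because
    [old_cells] determines [nu i]. *)
Lemma card_ext_tab (n : nat) eta (I : finType) (P : pred I) (nu : I -> shape)
    (B : forall i : I, {set {ffun cell (nu i) -> 'I_n}}) (B' : {set {ffun cell eta -> 'I_n.+1}}) :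
    {in P &, injective nu} -> (forall i : I, P i -> interlace (nu i) eta) ->
    (forall (i : I) T, P i -> T \in B i -> ext_tab eta T \in B') ->
  (\sum_(i | P i) #|B i| <= #|B'|)%N.
Proof.
move=> injnu int extB.
apply: (@leq_trans (\sum_(i | P i) #|[set T in B' | old_cells T == diag_set (nu i)]|)).
  apply: leq_sum => i Pi; rewrite -(card_imset _ (@ext_tab_inj n _ _ (int i Pi))).
  apply/subset_leq_card/fintype.subsetP => _ /imsetP[T TB ->].
  by rewrite inE extB //= old_cells_ext ?int.
under eq_bigr do rewrite -sum1_card big_mkcond /=.
rewrite exchange_big -sum1_card [leqRHS]big_mkcond /=; apply: leq_sum => T _.
have [TB|nTB] := boolP (T \in B'); last first.
  by rewrite big1 // => i _; rewrite inE (negPf nTB).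
rewrite -big_mkcondr /= sum1_card.
have [i0 /andP[Pi0 /eqP eq0]|none] :=
    pickP (fun i => P i && (old_cells T == diag_set (nu i))); last first.
  by rewrite (eq_card (B := pred0)) ?card0 // => i; rewrite unfold_in /= inE TB; exact: none.
rewrite (eq_card (B := pred1 i0)) ?card1 // => i; rewrite unfold_in /= inE TB inE /=.
apply/andP/eqP => [[Pi /eqP eqi]|->]; last by rewrite eq0 eqxx.
by apply: injnu => //; apply: diag_set_inj; rewrite -eqi -eq0.
Qed.

Definition ssyt n eta := [set T : {ffun cell eta -> 'I_n} | semistandard T].
Definition syt n eta := [set T in ssyt n eta | injectiveb T].

Lemma cell0 (c : cell ([ffun=> ord0] : shape)) : False.
Proof. by case: c => x; rewrite ffunE. Qed.

Lemma ffun_cell0 n : exists T : {ffun cell ([ffun=> ord0] : shape) -> 'I_n}, True.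
Proof. by exists [ffun c => match cell0 c with end]. Qed.

Lemma num_ssyt_le n eta : decreasing eta -> (num_ssyt n eta <= #|ssyt n eta|)%N.
Proof.
elim: n eta => [|n IHn] eta dec /=.
  have [->|] := eqVneq eta [ffun=> ord0]; last by [].
  have [T _] := ffun_cell0 0; apply/card_gt0P; exists T; rewrite inE.
  by apply/forallP => c; case: (cell0 c).
apply: leq_trans (@card_ext_tab n eta _ (fun nu => interlace nu eta) id
  (ssyt n) (ssyt n.+1 eta) _ _ _) => //.
- by apply: leq_sum => nu int; apply/IHn/(interlace_decreasing int).
- by move=> nu T int; rewrite !inE; apply: ext_tab_semistandard.
Qed.

Lemma del_box_interlace eta (i : 'I_m) : (0 < eta i)%N -> decreasing eta ->
  decreasing (del_box eta i) -> interlace (del_box eta i) eta.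
Proof.
move=> pos /decreasingP dec /decreasingP dec'; apply/interlaceP => j.
have := dec j; have := dec' j; rewrite !row_len_del.
by case: (eqVneq j i) => [->|]; case: (eqVneq j.+1 i); have := row_lenE eta i; lia.
Qed.

Lemma num_syt_le k eta : decreasing eta -> size_shape eta = k ->
  (num_syt k eta <= #|syt k eta|)%N.
Proof.
elim: k eta => [|k IHk] eta dec sz /=.
  have [->|] := eqVneq eta [ffun=> ord0]; last by [].
  have [T _] := ffun_cell0 0; apply/card_gt0P; exists T; rewrite !inE.
  by apply/andP; split; [apply/forallP => c|apply/injectiveP => c]; case: (cell0 c).
apply: leq_trans (@card_ext_tab k eta _ _ (del_box eta)
  (fun i => syt k (del_box eta i)) (syt k.+1 eta) _ _ _).
- apply: leq_sum => i /andP[pos dec']; apply: IHk => //.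
  have lt : (del_box eta i i < m)%N.
    by rewrite -row_lenE row_len_del row_lenE eqxx subn1 -ltnS prednK // ltn_ord.
  by move: sz; rewrite -{1}(del_boxK pos) size_add_box // => -[].
- move=> i i' /andP[pos _] /andP[pos' _] /(congr1 (fun nu => row_len nu i)).
  rewrite !row_len_del eqxx row_lenE; case: eqVneq => [/ord_inj//|_].
  by lia.
- by move=> i /andP[pos dec']; apply: del_box_interlace.
move=> i T /andP[pos dec'] ; rewrite !inE => /andP[ssT /injectiveP injT].
have int := del_box_interlace pos dec dec'.
rewrite ext_tab_semistandard //=; apply/injectiveP => c d eqT.
(* The only cell outside the smaller shape is the removed box, so the new letter is used once. *)
have new (e : cell eta) : (del_box eta i (val e).1 <= (val e).2)%N ->
    val e = (i, (val e).2) /\ (val e).2 = (eta i).-1 :> nat.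
  move=> le; have lt := valP e; move: le lt; rewrite -!row_lenE row_len_del.
  case: (eqVneq (nat_of_ord (val e).1) i) => [/ord_inj E|_]; last by lia.
  by rewrite E => le lt; split; [rewrite -{1}E -surjective_pairing|lia].
have eqT' := congr1 (@nat_of_ord _) eqT.
have [ltc|lec] := ltnP (val c).2 (del_box eta i (val c).1);
  have [ltd|led] := ltnP (val d).2 (del_box eta i (val d).1).
- pose c' : cell (del_box eta i) := exist _ (val c) ltc.
  pose d' : cell (del_box eta i) := exist _ (val d) ltd.
  move: eqT'; rewrite (@ext_tabE k _ eta T c c') // (@ext_tabE k _ eta T d d') //.
  by move=> /ord_inj/injT/(congr1 val) /= E; apply/val_inj.
- pose c' : cell (del_box eta i) := exist _ (val c) ltc.
  move: eqT'; rewrite (@ext_tabE k _ eta T c c') // (ext_tab_new T led) => E.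
  by have := ltn_ord (T c'); rewrite E ltnn.
- pose d' : cell (del_box eta i) := exist _ (val d) ltd.
  move: eqT'; rewrite (@ext_tabE k _ eta T d d') // (ext_tab_new T lec) => E.
  by have := ltn_ord (T d'); rewrite -E ltnn.
have [Ec Ec2] := new c lec; have [Ed Ed2] := new d led.
by apply/val_inj; rewrite Ec Ed; congr pair; apply/ord_inj; rewrite Ec2 Ed2.
Qed.

Lemma is_partition_decreasing eta :
  is_partition eta = decreasing eta && (size_shape eta == m).
Proof.
congr andb; apply/forallP/decreasingP => [dec j|dec i].
  have [ltj|lej] := ltnP j.+1 m; last by rewrite (row_len_out _ lej).
  have := dec (Ordinal (ltnW ltj)) => /forallP/(_ (Ordinal ltj))/implyP.
  by rewrite -!row_lenE /=; apply.
apply/forallP => j; apply/implyP => le; rewrite -!row_lenE.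
elim: {j}(nat_of_ord j) le => [|j IH]; first by rewrite leqn0 => /eqP->.
by rewrite leq_eqVlt ltnS => /orP[/eqP->//|/IH]; apply: leq_trans.
Qed.

(* Only this half of the RSK identity [sum_eta f^eta s_eta(1,...,1) = n^m] is
   needed: equality follows from a dimension count in [squeeze]. *)
Lemma exp_le_sum_tableaux n :
  (n ^ m <= \sum_(eta : shape | is_partition eta) #|syt m eta| * #|ssyt n eta|)%N.
Proof.
rewrite -(@sum_syt_ssyt m n m) // (eq_bigl _ _ is_partition_decreasing).
apply: leq_sum => eta /andP[dec /eqP sz].
by rewrite leq_mul ?num_syt_le ?num_ssyt_le.
Qed.

End TableauExtension.

(** * Semistandard tableaux give independent vectors *)

Section Rearrangement.
Variables (m : nat) (r c : 'I_m -> nat).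
Hypothesis dgm : diagram r c.
Implicit Types (v w : 'I_m -> nat) (p : 'S_m).

Definition row_sorted v := forall k l, r k = r l -> (c k <= c l)%N -> (v k <= v l)%N.

Lemma card_row_prefix k j : (j <= (c k).+1)%N ->
  #|[set l | (r l == r k) && (c l < j)%N]| = j.
Proof.
move=> lej; case: dgm => inj down.
have /fin_all_exists[h hP] (i : 'I_j) : exists l, r l = r k /\ c l = i.
  by apply: (down k) => //; rewrite -ltnS (leq_trans (ltn_ord i)).
have injh : injective h by move=> i i' E; apply/ord_inj; rewrite -(hP i).2 -(hP i').2 E.
rewrite -[RHS]card_ord -(card_imset predT injh); apply: eq_card => l; rewrite inE.
apply/andP/imsetP => [[/eqP rl lt]|[i _ ->]]; last by rewrite (hP i).1 (hP i).2 eqxx ltn_ord.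
by exists (Ordinal lt) => //; apply: inj; rewrite ?(hP _).1 ?(hP _).2.
Qed.

(** In a sorted row the letters below [t] fill an initial segment, so their number decides which
    cells they occupy. *)
Lemma row_sorted_lt v k t : row_sorted v ->
  (v k < t)%N = (c k < #|[set l | (r l == r k) && (v l < t)%N]|)%N.
Proof.
move=> sv; have [lt|le] := ltnP (v k) t.
  rewrite -[X in (X <= _)%N](@card_row_prefix k) //.
  apply/esym/subset_leq_card/fintype.subsetP => l; rewrite !inE ltnS => /andP[/eqP rl cl].
  by rewrite rl eqxx (leq_ltn_trans (sv _ _ rl cl) lt).
apply/esym/negbTE; rewrite -leqNgt -[X in (_ <= X)%N](@card_row_prefix k (c k)) //.
apply/subset_leq_card/fintype.subsetP => l; rewrite !inE => /andP[/eqP rl vl].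
rewrite rl eqxx ltnNge; apply: contraTN vl => cl; rewrite -leqNgt.
by apply: leq_trans le (sv _ _ _ cl).
Qed.

(** A row permutation preserves the number of letters below [t] in each row, and these numbers
    determine a sorted filling. *)
Lemma row_sorted_unique v p : (forall k, r (p k) = r k) ->
  row_sorted v -> row_sorted (v \o p) -> v \o p =1 v.
Proof.
move=> rp sv svp k; suff lt_iff t : (v (p k) < t)%N = (v k < t)%N.
  by apply/eqP; rewrite /= eqn_leq -ltnS lt_iff ltnSn -ltnS -lt_iff ltnSn.
rewrite -[v (p k)]/((v \o p) k) (row_sorted_lt _ _ svp) (row_sorted_lt _ _ sv).
congr (_ < _)%N; rewrite -[RHS](card_preimset _ (@perm_inj _ p)).
by apply: eq_card => l; rewrite !inE /= rp.
Qed.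

Definition col_weight v := (\sum_k c k * v k)%N.

(* A maximizer of [col_weight] among the row rearrangements of [v] is sorted:
   otherwise exchanging two entries would increase it. *)
Lemma col_weight_max_sorted v p : (forall k, r (p k) = r k) ->
    (forall p', (forall k, r (p' k) = r k) ->
      (col_weight (v \o p') <= col_weight (v \o p))%N) ->
  row_sorted (v \o p).
Proof.
move=> rp maxp k l rkl ckl; rewrite leqNgt; apply/negP => lt /=.
have neq : k != l by apply: contraTneq lt => ->; rewrite ltnn.
have ltc : (c k < c l)%N.
  by rewrite ltn_neqAle ckl andbT; apply: contraNneq neq => eqc; rewrite (dgm.1 k l).
have rt i : r ((tperm k l * p)%g i) = r i by rewrite permM rp; case: tpermP => // ->.
have := maxp _ rt; rewrite leqNgt => /negP; apply.
rewrite /col_weight (bigD1 k) //= (bigD1 l) 1?eq_sym //= [ltnRHS](bigD1 k) //=.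
rewrite [X in (_ < _ + X)%N](bigD1 l) 1?eq_sym //= !permM tpermL tpermR.
rewrite (eq_bigr (fun i => c i * v ((tperm k l * p)%g i))%N) => [|i /andP[nk nl]]; last first.
  by rewrite permM tpermD // eq_sym.
move: lt => /=; set s := (\sum_(i | _) _)%N; nia.
Qed.

(** The rearrangement inequality with its equality case: every maximizer is sorted, hence equal to
    [v] by uniqueness. *)
Lemma col_weight_sorted v p : (forall k, r (p k) = r k) -> row_sorted v ->
  (col_weight (v \o p) <= col_weight v)%N /\
  (col_weight (v \o p) = col_weight v -> v \o p =1 v).
Proof.
move=> rp sv; pose P := [pred p : 'S_m | [forall k, r (p k) == r k]].
have PP p' : reflect (forall k, r (p' k) = r k) (P p').
  by apply: (iffP forallP) => H k; apply/eqP.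
have [p0 /PP Pp0 max0] := @arg_maxnP _ p P (fun p => col_weight (v \o p)) (introT (PP p) rp).
have max0' p' : (forall k, r (p' k) = r k) ->
    (col_weight (v \o p') <= col_weight (v \o p0))%N.
  by move=> rp'; apply: max0; apply/PP.
have s0 := row_sorted_unique Pp0 sv (col_weight_max_sorted Pp0 max0').
have w0 : col_weight (v \o p0) = col_weight v.
  by apply: eq_bigr => k _; rewrite s0.
split=> [|weq]; first by rewrite -w0 max0'.
apply: row_sorted_unique => //; apply: col_weight_max_sorted => // p' rp'.
by rewrite weq -w0 max0'.
Qed.

End Rearrangement.

Lemma diagramC m (r c : 'I_m -> nat) : diagram r c -> diagram c r.
Proof.
move=> [inj down]; split=> [k l ck rk|k i j lei lej]; first exact: inj.
by have [l [rl cl]] := down k j i lej lei; exists l.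
Qed.

(** * The action of permutations on words *)

Section Words.
Variables (F : numFieldType) (m n : nat).
Local Notation word := {ffun 'I_m -> 'I_n}.
Implicit Types (w : word) (g : 'S_m).

(** The inverse makes this a right action, in accordance with the left-to-right product of
    permutations. *)
Definition word_act w g : word := [ffun k => w (g^-1%g k)].

Lemma word_act1 w : word_act w 1 = w.
Proof. by apply/ffunP => k; rewrite ffunE invg1 perm1. Qed.

Lemma word_actM w g h : word_act w (g * h) = word_act (word_act w g) h.
Proof. by apply/ffunP => k; rewrite !ffunE invMg permM. Qed.

Definition word_mx g : 'M[F]_#|{: word}| :=
  fmx (fun w w' => (w' == word_act w g)%:R).

Lemma word_mx_repr : mx_repr [set: 'S_m]%G word_mx.
Proof.
split=> [|g h _ _].
  rewrite -fmx1; apply: eq_fmx => w w'.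
  by rewrite word_act1 eq_sym.
rewrite /word_mx fmxM; apply: eq_fmx => w w'.
rewrite (bigD1 (word_act w g)) //= eqxx mul1r word_actM big1 ?addr0 // => w1 /negPf->.
by rewrite mul0r.
Qed.
Canonical word_repr := MxRepresentation word_mx_repr.

End Words.

(** * Triangularity of the Young symmetrizer on semistandard words *)

Section TableauVectors.
Variables (F : numFieldType) (m : nat) (eta : {ffun 'I_m -> 'I_m.+1}).
Hypothesis peta : is_partition eta.
Local Notation r := (tab_row eta).
Local Notation c := (tab_col eta).

Lemma tab_cells : exists h : 'I_m -> cell eta,
  bijective h /\ forall k, r k = (val (h k)).1 /\ c k = (val (h k)).2.
Proof.
have ex k : exists x : cell eta, r k = (val x).1 /\ c k = (val x).2.
  have [i ri ci] := tabP peta k.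
  have cm : (c k < m)%N by apply: leq_trans ci _; rewrite -ltnS ltn_ord.
  have ltx : ((i, Ordinal cm).2 < eta (i, Ordinal cm).1)%N by [].
  by exists (exist _ (i, Ordinal cm) ltx).
have [h hP] := fin_all_exists ex.
have /fin_all_exists[h' h'P] (x : cell eta) :
    exists k, r k = (val x).1 /\ c k = (val x).2.
  exact: tab_ex (valP x).
exists h; split=> //; exists h' => [k|x].
  have [h1 h2] := hP k; have [h3 h4] := h'P (h k).
  by apply: (@tab_inj _ eta); rewrite ?h3 ?h4 -?h1 -?h2.
have [h1 h2] := hP (h' x); have [h3 h4] := h'P x.
apply/val_inj; rewrite [LHS]surjective_pairing [RHS]surjective_pairing.
by congr pair; apply/ord_inj; rewrite -?h1 -?h2 ?h3 ?h4.
Qed.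

Variable n : nat.
Local Notation word := {ffun 'I_m -> 'I_n}.
Implicit Types (v w : word).

Definition semistandard_word w :=
  (forall k l, r k = r l -> (c k <= c l)%N -> (w k <= w l)%N) /\
  (forall k l, c k = c l -> (r k < r l)%N -> (w k < w l)%N).

(** The entry of the Young symmetrizer on words. It also gives its entries on the regular module,
    through permutations read as words. *)
Definition word_coef w w' : F :=
  \sum_(p in row_stab eta) \sum_(q in col_stab eta)
    (-1) ^+ (q : bool) * (w' == word_act w (p * q)%g)%:R.

Definition word_weight w := col_weight c (fun k => w k).

Let nw w := (fun k => nat_of_ord (w k)).

Lemma semistandard_col_inj w q : semistandard_word w -> q \in col_stab eta ->
  (forall k, w (q k) = w k) -> q = 1%g.
Proof.
move=> [_ ssw] /col_stabP qQ wq; apply/permP => k; rewrite perm1.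
apply: tab_inj; rewrite ?qQ //; have := ssw (q k) k (qQ k); have := ssw k (q k) (esym (qQ k)).
by rewrite wq ltnn; case: ltngtP => // _ H1 H2; [have := H1 isT|have := H2 isT].
Qed.

Lemma semistandard_col_sorted w : semistandard_word w -> row_sorted c r (nw w).
Proof.
move=> [_ ssw] k l ckl; rewrite leq_eqVlt => /orP[/eqP rkl|rkl].
  by rewrite (tab_inj rkl ckl).
exact/ltnW/ssw.
Qed.

(** The column permutation [q] does not affect the weight, and [p] can only lower it, so the
    hypothesis forces [p] to fix [w]. Then [w] and [w'] are sorted along columns and differ by a
    column permutation, hence agree; strictness in the columns gives [q = 1]. *)
Lemma word_act_semistandard w w' p q : semistandard_word w -> semistandard_word w' ->
    p \in row_stab eta -> q \in col_stab eta -> w' = word_act w (p * q)%g ->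
    (word_weight w <= word_weight w')%N ->
  w = w' /\ q = 1%g.
Proof.
move=> ssw ssw' pP qQ w'E le.
have w'q k : w' (q k) = w (p^-1%g k).
  by rewrite w'E ffunE invMg permM permK.
have pP' k : r (p^-1%g k) = r k.
  by move/row_stabP: pP => pP; rewrite -{2}(permKV p k) pP.
have qQ' k : c (q k) = c k by move/col_stabP: qQ.
have wt : word_weight w' = col_weight c (nw w \o p^-1%g).
  rewrite /word_weight /col_weight (reindex_inj (@perm_inj _ q)) /=.
  by apply: eq_bigr => k _; rewrite qQ' w'q.
have [le' eqw] := col_weight_sorted (tab_diagram peta) pP' (v := nw w) ssw.1.
have wp k : w (p^-1%g k) = w k.
  apply/ord_inj/eqw/eqP; rewrite eqn_leq le' -wt; exact: le.
have ww' k : nw w k = nw w' k.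
  have := row_sorted_unique (diagramC (tab_diagram peta)) qQ'
    (semistandard_col_sorted ssw') => <- //=.
    by rewrite /nw w'q wp.
  move=> i j cij rij; rewrite /= /nw !w'q !wp.
  exact: (semistandard_col_sorted ssw).
have eqww : w = w' by apply/ffunP => k; apply/ord_inj/ww'.
by split=> //; apply: semistandard_col_inj ssw' qQ _ => k; rewrite w'q wp eqww.
Qed.

(** Only [q = 1] contributes, with sign +1, so the entry counts the row permutations fixing [w]. *)
Lemma word_coef_diag w : semistandard_word w -> word_coef w w != 0.
Proof.
move=> ssw; pose P := [set p in row_stab eta | word_act w p == w].
suff -> : word_coef w w = #|P|%:R.
  rewrite pnatr_eq0 -lt0n; apply/card_gt0P; exists 1%g.
  by rewrite inE word_act1 eqxx andbT; apply/row_stabP => k; rewrite perm1.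
rewrite -sum1_card natr_sum /word_coef big_mkcond [RHS]big_mkcond /=.
apply: eq_bigr => p _; rewrite [in RHS]inE; case: ifP => //= pP.
rewrite (bigD1 1%g) /=; last by apply/col_stabP => k; rewrite perm1.
rewrite mulg1 odd_perm1 mul1r big1 ?addr0 => [|q /andP[qQ neq1]].
  by rewrite eq_sym; case: eqP.
case: eqP => [E|]; last by rewrite mulr0.
have [_ q1] := word_act_semistandard ssw ssw pP qQ E (leqnn _).
by rewrite q1 eqxx in neq1.
Qed.

Lemma word_coef_lt w w' : semistandard_word w -> semistandard_word w' ->
  w != w' -> word_coef w w' != 0 -> (word_weight w' < word_weight w)%N.
Proof.
move=> ssw ssw' neq; apply: contraR; rewrite -leqNgt => le.
rewrite /word_coef big1 // => p pP; rewrite big1 // => q qQ.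
case: eqP => [E|]; last by rewrite mulr0.
have [eqw _] := word_act_semistandard ssw ssw' pP qQ E le.
by rewrite eqw eqxx in neq.
Qed.

End TableauVectors.

(** In a linear relation, take a nonzero coefficient whose index maximizes [f]; in the column [b] of
    that index no other term survives. *)
Lemma row_free_triangular (F : fieldType) (I : finType) (S : {set I}) N1 N2
    (M : 'M[F]_(N1, N2)) (a : I -> 'I_N1) (b : I -> 'I_N2) (f : I -> nat) :
    (forall i, i \in S -> M (a i) (b i) != 0) ->
    (forall i j, i \in S -> j \in S -> i != j -> M (a i) (b j) != 0 -> (f j < f i)%N) ->
  row_free (\matrix_(i < #|S|) row (a (enum_val i)) M).
Proof.
move=> diag tri; set B := \matrix_(i < _) _.
rewrite -kermx_eq0; apply/rowV0P => v /sub_kermxP vB.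
apply/eqP; apply: contraT => /rV0Pn[i0 nz0].
have [i nzi maxi] := @arg_maxnP _ i0 (fun i => v 0 i != 0) (fun i => f (enum_val i)) nz0.
have := congr1 (fun A : 'rV[F]_N2 => A 0 (b (enum_val i))) vB.
rewrite !mxE (bigD1 i) //= big1 => [|j neq]; last first.
  rewrite !mxE; have [->|nzj] := eqVneq (v 0 j) 0; first by rewrite mul0r.
  apply/eqP; rewrite mulf_eq0 (negPf nzj) /=; apply: contraT.
  move/(tri _ _ (enum_valP j) (enum_valP i)).
  rewrite (inj_eq enum_val_inj) => /(_ neq); rewrite ltnNge => /negP[].
  exact: maxi.
rewrite addr0 !mxE => /eqP; rewrite mulf_eq0 (negPf nzi).
by rewrite (negPf (diag _ (enum_valP i))).
Qed.

(** * The isotypic decomposition of the space of words *)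

Section Squeeze.
Variables (F : numFieldType) (m : nat).
Local Notation shape := {ffun 'I_m -> 'I_m.+1}.
Local Notation reg := (regular_repr F [set: 'S_m]%G).
Local Notation wrep n := (word_repr F m n).
Implicit Types eta nu : shape.

Lemma ysym_wordE n eta (w w' : {ffun 'I_m -> 'I_n}) :
  ysym eta (wrep n) (enum_rank w) (enum_rank w') = word_coef F eta w w'.
Proof.
rewrite ysymE summxE; apply: eq_bigr => p _; rewrite summxE.
by apply: eq_bigr => q _; rewrite mxE fmxE.
Qed.

(** Permutations as words without repetition on [m] letters, which lets the regular module share the
    estimates made for words. *)
Definition perm_word (g : 'S_m) : {ffun 'I_m -> 'I_m} := [ffun k => g^-1%g k].

Lemma perm_word_act g h : word_act (perm_word g) h = perm_word (g * h)%g.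
Proof. by apply/ffunP => k; rewrite !ffunE invMg permM. Qed.

Lemma perm_word_inj : injective perm_word.
Proof.
move=> g h /ffunP E; apply: invg_inj; apply/permP => k.
by have := E k; rewrite !ffunE.
Qed.

Lemma ysym_regE eta g h :
  ysym eta reg (gring_index [set: 'S_m]%G g) (gring_index [set: 'S_m]%G h)
  = word_coef F eta (perm_word g) (perm_word h).
Proof.
rewrite ysymE summxE; apply: eq_bigr => p _; rewrite summxE.
apply: eq_bigr => q _; rewrite !mxE eqxx /= gring_indexK ?inE //.
rewrite perm_word_act (inj_eq perm_word_inj).
by rewrite (can_in_eq (@gring_indexK _ [set: 'S_m]%G)) ?inE.
Qed.

Section OneShape.
Variable eta : shape.
Hypothesis peta : is_partition eta.
Local Notation kappa := (ykappa F eta).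

Section Letters.
Variable n : nat.
Variable h : 'I_m -> cell eta.
Hypothesis bij_h : bijective h.
Hypothesis hP : forall k, tab_row eta k = (val (h k)).1 /\ tab_col eta k = (val (h k)).2.

Definition tab_word (T : {ffun cell eta -> 'I_n}) : {ffun 'I_m -> 'I_n} :=
  [ffun k => T (h k)].

Lemma tab_word_inj : injective tab_word.
Proof.
case: bij_h => h' hK h'K T T' /ffunP E; apply/ffunP => x.
by have := E (h' x); rewrite !ffunE h'K.
Qed.

Lemma tab_word_semistandard T : semistandard T -> semistandard_word eta (tab_word T).
Proof.
move=> /forallP ssT; split=> k l.
  rewrite !(hP _).1 !(hP _).2 !ffunE => /ord_inj E le.
  by have /forallP/(_ (h l))/andP[/implyP + _] := ssT (h k); apply; rewrite E eqxx.
rewrite !(hP _).1 !(hP _).2 !ffunE => /ord_inj E lt.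
by have /forallP/(_ (h l))/andP[_ /implyP] := ssT (h k); apply; rewrite E eqxx.
Qed.

Definition tab_vectors := \matrix_(i < #|ssyt n eta|)
  row (enum_rank (tab_word (enum_val i))) (ysym eta (wrep n)).

Lemma tab_vectors_free : row_free tab_vectors.
Proof.
apply: (@row_free_triangular _ _ _ _ _ _ (fun T => enum_rank (tab_word T))
  (fun T => enum_rank (tab_word T)) (fun T => word_weight eta (tab_word T))) => [T|T T'].
  by rewrite inE ysym_wordE => ssT; apply/word_coef_diag/tab_word_semistandard.
rewrite !inE ysym_wordE => ssT ssT' neq; apply: word_coef_lt => //.
- exact: tab_word_semistandard.
- exact: tab_word_semistandard.
- by rewrite (inj_eq tab_word_inj).
Qed.

Lemma tab_vectors_sub : (tab_vectors <= ysym eta (wrep n))%MS.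
Proof. by apply/row_subP => i; rewrite rowK row_sub. Qed.

End Letters.

Lemma rank_ysym_ge n : (#|ssyt n eta| <= \rank (ysym eta (wrep n)))%N.
Proof.
have [h [bij_h hP]] := tab_cells peta.
have := mxrankS (tab_vectors_sub n h).
by have := tab_vectors_free n bij_h hP; rewrite /row_free => /eqP->.
Qed.

Lemma rank_reg_ge : (#|syt m eta| <= \rank (ysym eta reg))%N.
Proof.
have [h [bij_h hP]] := tab_cells peta.
have injw T : T \in syt m eta -> injective (tab_word h T).
  rewrite inE => /andP[_ /injectiveP injT] k l; rewrite !ffunE => /injT.
  exact: bij_inj.
(* [pw T] is the permutation whose word is that of [T]; the inverse cancels the one in [perm_word],
   and 1 is a dummy value for tableaux with repeated letters. *)
pose pw T := if @idP (injectiveb (tab_word h T)) is ReflectT inj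
  then (perm (injectiveP _ inj))^-1%g else 1%g.
have pwE T : T \in syt m eta -> perm_word (pw T) = tab_word h T.
  move=> /injw/injectiveP inj; apply/ffunP => k; rewrite ffunE /pw.
  by case: {-}_ / idP => [inj'|/(_ inj)//]; rewrite invgK permE.
set M := ysym eta reg.
pose B := \matrix_(i < #|syt m eta|) row (gring_index [set: 'S_m]%G (pw (enum_val i))) M.
have : row_free B.
  apply: (@row_free_triangular _ _ _ _ _ _ (fun T => gring_index [set: 'S_m]%G (pw T))
    (fun T => gring_index [set: 'S_m]%G (pw T)) (fun T => word_weight eta (tab_word h T))).
    move=> T TS; rewrite ysym_regE pwE //; apply/word_coef_diag => //.
    by apply/tab_word_semistandard => //; move: TS; rewrite !inE => /andP[].
  move=> T T' TS TS' neq; rewrite ysym_regE !pwE //; apply: word_coef_lt => //.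
  - by apply/tab_word_semistandard => //; move: TS; rewrite !inE => /andP[].
  - by apply/tab_word_semistandard => //; move: TS'; rewrite !inE => /andP[].
  - by rewrite (inj_eq (tab_word_inj bij_h)).
rewrite /row_free => /eqP <-; apply: mxrankS.
by apply/row_subP => i; rewrite rowK row_sub.
Qed.

End OneShape.

Lemma idem_trace0 N (X : 'M[F]_N) : X *m X = X -> \tr X = 0 -> X = 0.
Proof.
move=> XX; rewrite (mxtrace_quasi_idem_rank (k := 1)) ?scale1r // mul1r.
by move/eqP; rewrite pnatr_eq0 mxrank_eq0 => /eqP.
Qed.

Definition isotypic n eta := (ykappa F eta ^- 2) *: zsym eta (wrep n).

Lemma isotypic_trace n eta : is_partition eta -> \tr (isotypic n eta)
  = (\rank (ysym eta reg) * \rank (ysym eta (wrep n)))%:R.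
Proof.
move=> peta; have k0 := ykappa_neq0 F peta.
rewrite mxtraceZ mxtrace_zsym -(ykappa_rank F peta).
rewrite (mxtrace_quasi_idem_rank (ysym_sqr _ peta)) natrM mulrACA -expr2.
by rewrite mulKf ?expf_neq0.
Qed.

Lemma sum_isotypic_idem n :
  (\sum_(eta | is_partition eta) isotypic n eta) *m
  (\sum_(eta | is_partition eta) isotypic n eta) = \sum_(eta | is_partition eta) isotypic n eta.
Proof.
rewrite mulmx_suml; apply: eq_bigr => eta peta; rewrite mulmx_sumr (bigD1 eta) //=.
rewrite /isotypic -scalemxAl -scalemxAr zsym_sqr // big1 ?addr0 => [|nu /andP[pnu neq]].
  by rewrite !scalerA mulfVK ?expf_neq0 ?ykappa_neq0.
by rewrite -scalemxAl -scalemxAr zsym_orth ?scaler0 // eq_sym.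
Qed.

(** The sum [E] of the isotypic projections is idempotent, with trace the sum of products of ranks.
    The tableau count bounds this sum below by [n ^ m], the dimension bounds it above, so every
    inequality in between is an equality. *)
Lemma squeeze n :
  \sum_(eta | is_partition eta) isotypic n eta = 1%:M /\
  (forall eta, is_partition eta -> \rank (ysym eta (wrep n)) = #|ssyt n eta|).
Proof.
set E := \sum_(eta | _) _.
pose d eta := \rank (ysym eta reg); pose r eta := \rank (ysym eta (wrep n)).
have trE : \tr E = (\sum_(eta | is_partition eta) d eta * r eta)%:R.
  by rewrite mxtrace_sum natr_sum; apply: eq_bigr => eta /isotypic_trace->.
have EE : E *m E = E := sum_isotypic_idem n.
have E1 : (1%:M - E) *m (1%:M - E) = 1%:M - E.
  by rewrite mulmxBl mul1mx mulmxBr mulmx1 EE subrr subr0.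
have trE1 : \tr (1%:M - E) = (n ^ m)%:R - \tr E.
  by rewrite linearB /= mxtrace1; congr (_%:R - _); rewrite card_ffun !card_ord.
(* The trace of the idempotent [1 - E] is its rank, hence nonnegative. *)
have le1 : (\sum_(eta | is_partition eta) d eta * r eta <= n ^ m)%N.
  rewrite -(ler_nat F) -trE -subr_ge0 -trE1.
  by rewrite (mxtrace_quasi_idem_rank (k := 1)) ?scale1r // mul1r ler0n.
have le2 := exp_le_sum_tableaux m n.
have le3 eta : is_partition eta -> (#|syt m eta| * #|ssyt n eta| <= d eta * r eta)%N.
  by move=> peta; rewrite leq_mul ?rank_reg_ge ?rank_ysym_ge.
have eq3 : (\sum_(eta | is_partition eta) d eta * r eta = n ^ m)%N.
  apply/eqP; rewrite eqn_leq le1 (leq_trans le2) //.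
  by apply: leq_sum => eta; apply: le3.
split.
  apply/esym/subr0_eq/(idem_trace0 E1).
  by rewrite trE1 trE eq3 subrr.
move=> eta peta; apply/eqP; rewrite eqn_leq rank_ysym_ge // andbT leqNgt.
apply/negP => lt; have d_gt0 : (0 < d eta)%N.
  rewrite lt0n; apply: contraNneq (fact_neq0 F m) => d0.
  by rewrite -(ykappa_rank F peta) -/(d eta) d0 mulr0.
suff : (n ^ m < \sum_(eta | is_partition eta) d eta * r eta)%N by rewrite eq3 ltnn.
apply: leq_ltn_trans le2 _; rewrite (bigD1 eta) //= [ltnRHS](bigD1 eta) //= -addSn.
rewrite leq_add //; last by apply: leq_sum => nu /andP[/le3].
apply: leq_ltn_trans (_ : (_ <= d eta * #|ssyt n eta|)%N) _.
  by rewrite leq_mul2r rank_reg_ge ?orbT.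
by rewrite ltn_pmul2l.
Qed.

Definition diag_tensor n (x : 'I_n -> F) : 'M[F]_#|{: {ffun 'I_m -> 'I_n}}| :=
  diag_mx (\row_i \prod_k x ((enum_val i : {ffun 'I_m -> 'I_n}) k)).

Lemma diag_tensor_comm n (x : 'I_n -> F) (g : 'S_m) :
  diag_tensor x *m wrep n g = wrep n g *m diag_tensor x.
Proof.
rewrite mul_diag_mx mul_mx_diag; apply/matrixP => i j; rewrite !mxE mulrC.
case: eqP => [->|]; last by rewrite !mul0r.
by congr (_ * _); rewrite [RHS](reindex_inj (@perm_inj _ g)); apply: eq_bigr => k _;
  rewrite ffunE permK.
Qed.

(** By the rank equality of [squeeze] the tableau vectors form a basis of the row space, and each is
    an eigenvector whose eigenvalue is the monomial of its tableau. The trace formula for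
    quasi-idempotents then sums these monomials. *)
Lemma mxtrace_ysym_diag n (x : 'I_n -> F) eta : is_partition eta ->
  \tr (ysym eta (wrep n) *m diag_tensor x) = ykappa F eta * schur eta x.
Proof.
move=> peta; have [h [bij_h hP]] := tab_cells peta.
pose B := tab_vectors n h; pose wt (T : {ffun cell eta -> 'I_n}) := \prod_(c : cell eta) x (T c).
have eqB : (B :=: ysym eta (wrep n))%MS.
  apply/eqmxP; rewrite tab_vectors_sub //= -(geq_leqif (mxrank_leqif_sup (tab_vectors_sub n h))).
  have := tab_vectors_free peta n bij_h hP; rewrite /row_free => /eqP->.
  by rewrite (squeeze n).2.
have BD : B *m diag_tensor x =
    diag_mx (\row_(i < #|ssyt n eta|) wt (enum_val i)) *m B.
  apply/row_matrixP => i; rewrite row_mul rowK row_diag_mul mxE rowK -row_mul.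
  rewrite -(comm_ysym _ (diag_tensor_comm x)) row_diag_mul mxE enum_rankK /wt.
  congr (_ *: _); have [h' hK h'K] := bij_h.
  rewrite [RHS](reindex h); last by exists h' => y _.
  by apply: eq_bigr => k _; rewrite ffunE.
rewrite (mxtrace_quasi_idem (ysym_sqr _ peta) (tab_vectors_free peta n bij_h hP) eqB BD).
rewrite mxtrace_diag; congr (_ * _).
rewrite /schur (eq_bigl (fun T => T \in ssyt n eta)) => [|T]; last by rewrite inE.
by rewrite [RHS]big_enum_val; apply: eq_bigr => i _; rewrite mxE.
Qed.

End Squeeze.

(** * The commutant of the unitary group *)

Section Tensors.
Variables (F : numFieldType) (m n : nat).
Local Notation word := {ffun 'I_m -> 'I_n}.
Implicit Types (M : 'M[F]_n) (w z : word).

Definition tens M : 'M[F]_#|{: word}| :=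
  fmx (fun w w' : word => \prod_k M (w k) (w' k)).

Lemma tens_mul M N : tens (M *m N) = tens M *m tens N.
Proof.
rewrite /tens fmxM; apply: eq_fmx => w w'.
under eq_bigr do rewrite mxE.
rewrite bigA_distr_bigA /=; apply: eq_bigr => z _.
by rewrite big_split.
Qed.

Lemma tens_diag (d : 'rV[F]_n) : tens (diag_mx d) = diag_tensor m (d 0).
Proof.
apply/matrixP => i j; rewrite !mxE; have [->|neq] := eqVneq i j.
  by rewrite mulr1n; apply: eq_bigr => k _; rewrite mxE eqxx mulr1n.
rewrite mulr0n; apply/eqP; rewrite prodf_seq_eq0; apply/hasP.
have [k nk|eqw] := pickP (fun k => (enum_val i : word) k != (enum_val j : word) k).
  by exists k; rewrite ?mem_index_enum //= mxE (negPf nk) mulr0n.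
case/eqP: neq; apply: enum_val_inj; apply/ffunP => k.
by apply/eqP; move: (eqw k) => /= /negbFE.
Qed.

Lemma tens1 : tens 1%:M = 1%:M.
Proof.
rewrite -diag_const_mx tens_diag -[RHS]diag_const_mx; congr diag_mx.
by apply/rowP => i; rewrite !mxE big1 // => k _; rewrite mxE.
Qed.

Lemma word_act_eq w z (g : 'S_m) : (z == word_act w g) = (w == word_act z g^-1%g).
Proof.
apply/eqP/eqP => ->; rewrite -word_actM ?mulgV ?mulVg word_act1 //.
Qed.

Lemma tens_word_comm M (g : 'S_m) :
  tens M *m word_repr F m n g = word_repr F m n g *m tens M.
Proof.
rewrite /= /word_mx !fmxM; apply: eq_fmx => w w'.
rewrite (bigD1 (word_act w' g^-1%g)) //= [X in _ + X = _]big1 ?addr0 => [|z]; last first.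
  by move=> neq; rewrite word_act_eq (negPf neq) mulr0.
rewrite word_act_eq eqxx mulr1 [RHS](bigD1 (word_act w g)) //= [X in _ = _ + X]big1 ?addr0 => [|z]; last first.
  by move=> /negPf->; rewrite mul0r.
rewrite eqxx mul1r [RHS](reindex_inj (@perm_inj _ g)); apply: eq_bigr => k _.
by rewrite !ffunE permK invgK.
Qed.

End Tensors.

Section Commutant.
Variables (C : numClosedFieldType) (m n : nat).
Local Notation word := {ffun 'I_m -> 'I_n}.
Implicit Types (M : 'M[C]_n) (w z : word).

(** For i < j, a root of -1 of order j - i satisfies x^j = -x^i. *)
Lemma unit_circle_separates (p q : nat) : p != q ->
  exists2 x : C, x * x^* = 1 & x ^+ p != x ^+ q.
Proof.
suff H (i j : nat) : (i < j)%N -> exists2 x : C, x * x^* = 1 & x ^+ i != x ^+ j.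
  by case: ltngtP => // /H[x x1 nx] _; exists x; rewrite // eq_sym.
move=> lt; have k_gt0 : (0 < j - i)%N by rewrite subn_gt0.
exists ((j - i).-root (-1)).
  rewrite -normCK; apply/eqP; rewrite sqrp_eq1 // -(pexpr_eq1 k_gt0) //.
  by rewrite -normrX rootCK // normrN1.
have expE (y : C) : y ^+ j = y ^+ i * y ^+ (j - i) by rewrite -exprD subnKC // ltnW.
rewrite expE rootCK // mulrN1.
by rewrite -subr_eq0 opprK -mulr2n mulrn_eq0 /= expf_neq0 // rootC_eq0 // oppr_eq0 oner_eq0.
Qed.

Variable E : 'M[C]_#|{: word}|.
Hypothesis E_unitary : forall u, u \is unitarymx -> E *m tens m u = tens m u *m E.
Local Notation e w w' := (E (enum_rank w) (enum_rank w')).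

Lemma tens_commE M w w' : E *m tens m M = tens m M *m E ->
  \sum_(z : word) e w z * \prod_k M (z k) (w' k) =
  \sum_(z : word) (\prod_k M (w k) (z k)) * e z w'.
Proof.
rewrite /tens [X in X *m _](fmx_surj E) [X in _ = _ *m X](fmx_surj E) !fmxM.
move/(congr1 (fun A : 'M[C]_#|{: word}| => A (enum_rank w) (enum_rank w'))).
by rewrite !fmxE.
Qed.

Definition letter_count w a := #|[set k | w k == a]|.

Lemma prod_letters (d : 'I_n -> C) w :
  \prod_k d (w k) = \prod_a d a ^+ letter_count w a.
Proof.
rewrite (partition_big w xpredT) //=; apply: eq_bigr => a _.
rewrite (eq_bigr (fun=> d a)) => [|k /eqP->//].
by rewrite prodr_const; congr (_ ^+ _); apply: eq_card => k; rewrite inE.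
Qed.

Lemma diag_tensor_commE (d : 'I_n -> C) w w' :
  E *m diag_tensor m d = diag_tensor m d *m E ->
  e w w' * \prod_k d (w' k) = (\prod_k d (w k)) * e w w'.
Proof.
rewrite mul_diag_mx mul_mx_diag.
move/(congr1 (fun A : 'M[C]_#|{: word}| => A (enum_rank w) (enum_rank w'))).
by rewrite !mxE !enum_rankK.
Qed.

(** Commutation with the diagonal unitary matrix having [x] at [a] and 1 elsewhere compares the
    powers of [x] given by the two letter counts. *)
Lemma E_content w w' a : e w w' != 0 -> letter_count w a = letter_count w' a.
Proof.
move=> nz; apply/eqP; apply: contraT => /unit_circle_separates[x x1 nx].
pose d : 'rV[C]_n := \row_b (if b == a then x else 1).
have ud : diag_mx d \is unitarymx.
  apply/unitarymxP; rewrite tr_diag_mx map_diag_mx mulmx_diag -diag_const_mx.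
  congr diag_mx; apply/rowP => b; rewrite !mxE.
  by case: ifP => _; rewrite ?x1 // rmorph1 mul1r.
have := E_unitary ud; rewrite tens_diag => /(@diag_tensor_commE _ w w').
rewrite mulrC => /(mulIf nz); rewrite !prod_letters.
have pE v : \prod_b (d 0 b) ^+ letter_count v b = x ^+ letter_count v a.
  rewrite (bigD1 a) //= mxE eqxx big1 ?mulr1 // => b /negPf nb.
  by rewrite mxE nb expr1n.
by rewrite !pE => E'; rewrite E' eqxx in nx.
Qed.

Lemma E_diag (d : 'rV[C]_n) : E *m tens m (diag_mx d) = tens m (diag_mx d) *m E.
Proof.
rewrite tens_diag /diag_tensor mul_diag_mx mul_mx_diag; apply/matrixP => a b.
rewrite !mxE -[a]enum_valK -[b]enum_valK !enum_rankK.
have [->|nz] := eqVneq (e (enum_val a) (enum_val b)) 0; first by rewrite mul0r mulr0.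
rewrite mulrC !prod_letters; congr (_ * _).
by apply: eq_bigr => l _; rewrite (E_content l nz).
Qed.

Lemma E_hermitian M : M^t* = M -> E *m tens m M = tens m M *m E.
Proof.
move=> hM; have /orthomx_spectralP-> : M \is normalmx by apply/normalmxP; rewrite hM.
have uP := spectral_unitarymx M; have uP' : invmx (spectralmx M) \is unitarymx.
  by rewrite invmx_unitary // trmxC_unitary.
rewrite !tens_mul !mulmxA E_unitary // -!mulmxA; congr (_ *m _).
by rewrite mulmxA E_diag -!mulmxA E_unitary.
Qed.

Lemma poly_nat_roots (p : {poly C}) : (forall t : nat, p.[t%:R] = 0) -> p = 0.
Proof.
move=> p0; apply/eqP; apply: contraT => nzp.
have := max_poly_roots nzp (rs := [seq t%:R | t <- iota 0 (size p)]).
rewrite size_map size_iota ltnn => -> //.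
  by apply/allP => _ /mapP[t _ ->]; rewrite rootE p0.
by rewrite map_inj_uniq ?iota_uniq // => s t /eqP; rewrite eqr_nat => /eqP.
Qed.

(** Write [M] as H1 + i H2 with both parts Hermitian. For natural [t] the matrix H1 + t H2 is
    Hermitian, so each entry of the commutator is a polynomial in [t] with infinitely many zeros;
    its value at t = i is the claim. *)
Lemma E_all M : E *m tens m M = tens m M *m E.
Proof.
have [H1 [H2 [h1 h2 MH]]] : exists H1, exists H2,
    [/\ H1^t* = H1, H2^t* = H2 & M = H1 + 'i *: H2].
  exists (2^-1 *: (M + M^t*)), ((2 * 'i)^-1 *: (M - M^t*)); split.
  - apply/matrixP => a b; rewrite !mxE rmorphM rmorphD /= conjCK fmorphV rmorph_nat.
    by rewrite addrC.
  - apply/matrixP => a b; rewrite !mxE rmorphM rmorphB /= conjCK fmorphV rmorphM /=.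
    by rewrite rmorph_nat conjCi mulrN invrN mulNr -mulrN opprB.
  rewrite scalerA invfM mulrCA mulfV ?neq0Ci // mulr1 -scalerDr addrACA addrN addr0.
  by rewrite -mulr2n -scaler_nat scalerA mulVf ?pnatr_eq0 // scale1r.
have hH (t : nat) : (H1 + t%:R *: H2)^t* = H1 + t%:R *: H2.
  have h1' a b : ((H1 b a)^*)%R = H1 a b by rewrite -[in RHS]h1 !mxE.
  have h2' a b : ((H2 b a)^*)%R = H2 a b by rewrite -[in RHS]h2 !mxE.
  by apply/matrixP => a b; rewrite !mxE rmorphD rmorphM rmorph_nat /= h1' h2'.
pose pol (a b : 'I_n) : {poly C} := (H1 a b)%:P + (H2 a b) *: 'X.
have polE a b x : (pol a b).[x] = (H1 + x *: H2) a b.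
  by rewrite !hornerE !mxE mulrC.
rewrite [E](fmx_surj E) /tens !fmxM; apply: eq_fmx => w w'.
pose p : {poly C} := \sum_(z : word) (e w z)%:P * \prod_k pol (z k) (w' k)
  - \sum_(z : word) (\prod_k pol (w k) (z k)) * (e z w')%:P.
have pE x : p.[x] = \sum_(z : word) e w z * \prod_k (H1 + x *: H2) (z k) (w' k)
    - \sum_(z : word) (\prod_k (H1 + x *: H2) (w k) (z k)) * e z w'.
  rewrite /p hornerD hornerN !horner_sum; congr (_ - _); apply: eq_bigr => z _.
    by rewrite hornerM hornerC horner_prod; congr (_ * _); apply: eq_bigr => k _.
  by rewrite hornerM hornerC horner_prod; congr (_ * _); apply: eq_bigr => k _.
have p0 : p = 0.
  apply: poly_nat_roots => t; rewrite pE (tens_commE _ _ (E_hermitian (hH t))).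
  by rewrite subrr.
by have := pE 'i%R; rewrite p0 horner0 -MH => /esym/eqP; rewrite subr_eq0 => /eqP.
Qed.

(* Write any word as [phi \o w0] with [w0] injective and evaluate
   [E (tens M) = (tens M) E], for [M] the matrix of [phi], at row [w0]. *)
Lemma commutant_word (w0 : word) : injective w0 ->
  E = \sum_g e w0 (word_act w0 g) *: word_repr C m n g.
Proof.
move=> inj0; rewrite [LHS](fmx_surj E).
transitivity (fmx (fun w w' : word =>
    \sum_g e w0 (word_act w0 g) * (w' == word_act w g)%:R)); last first.
  apply/matrixP => a b; rewrite mxE summxE; apply: eq_bigr => g _.
  by rewrite !mxE.
apply: eq_fmx => w w'.
(* [phi] carries [w0] to [w]; its values on letters outside [w0] are arbitrary. *)
pose phi a := if [pick k | w0 k == a] is Some k then w k else a.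
have phiE k : phi (w0 k) = w k.
  rewrite /phi; case: pickP => [l /eqP/inj0->//|/(_ k)]; by rewrite eqxx.
pose M : 'M[C]_n := \matrix_(a, b) (b == phi a)%:R.
have prodM z z' : \prod_k M (z k) (z' k) = (z' == [ffun k => phi (z k)])%:R.
  have [->|neq] := eqVneq z' [ffun k => phi (z k)].
    by rewrite big1 // => k _; rewrite mxE ffunE eqxx.
  have [k nk|eqz] := pickP (fun k => z' k != phi (z k)).
    by rewrite (bigD1 k) //= mxE (negPf nk) mul0r.
  case/eqP: neq; apply/ffunP => k; rewrite ffunE.
  by apply/eqP; move: (eqz k) => /= /negbFE.
have := tens_commE w0 w' (E_all M).
under [X in X = _]eq_bigr do rewrite prodM.
under [X in _ = X]eq_bigr do rewrite prodM.
rewrite [X in _ = X](bigD1 w) //=; last first.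
have phi0 : [ffun k => phi (w0 k)] = w by apply/ffunP => k; rewrite ffunE phiE.
rewrite phi0 eqxx mul1r [X in _ = _ + X]big1 ?addr0 => [<-|z /negPf->]; last by rewrite mul0r.
have inj_act : injective (word_act w0).
  move=> g h /ffunP eqgh; apply: invg_inj; apply/permP => k.
  by apply: inj0; have := eqgh k; rewrite !ffunE.
(* By [E_content], row [w0] of [E] vanishes outside the rearrangements of [w0]. *)
rewrite (bigID (mem [set word_act w0 g | g : 'S_m])) /= [X in _ + X]big1 ?addr0 => [|z nz].
  rewrite big_imset /=; last by move=> g h _ _; apply: inj_act.
  apply: eq_big => [g|g _]; first by rewrite inE.
  congr (_ * (_ == _)%:R); apply/ffunP => k.
  by rewrite !ffunE phiE.
have [->|nze] := eqVneq (e w0 z) 0; first by rewrite mul0r.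
case/negP: nz; have cnt a := E_content a nze.
have cnt0 k : letter_count w0 (w0 k) = 1%N.
  rewrite /letter_count (_ : [set l | w0 l == w0 k] = [set k]) ?cards1 //.
  by apply/setP => l; rewrite !inE (inj_eq inj0).
have /fin_all_exists[f fP] (k : 'I_m) : exists l, w0 k = z l.
  have : (0 < letter_count z (w0 k))%N by rewrite -cnt cnt0.
  by case/card_gt0P => l; rewrite inE => /eqP <-; exists l.
have injf : injective f by move=> k l eqf; apply: inj0; rewrite !fP eqf.
apply/imsetP; exists (perm injf) => //; apply/ffunP => k.
by rewrite ffunE fP -[f _](permE injf) permKV.
Qed.

End Commutant.

(** * Traces of tensor powers against permutations *)

Section TensorTraces.
Variables (C : numClosedFieldType) (m n : nat).
Local Notation word := {ffun 'I_m -> 'I_n}.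
Local Notation wrep := (word_repr C m n).
Implicit Types (M : 'M[C]_n) (w z : word).

Lemma mxtrace_tens_word M (g : 'S_m) :
  \tr (tens m M *m wrep g) = \sum_(w : word) \prod_k M (w k) (w (g k)).
Proof.
rewrite /= /word_mx fmxM mxtrace_fmx; apply: eq_bigr => w _.
rewrite (bigD1 (word_act w g^-1%g)) //= [X in _ + X]big1 ?addr0 => [|z neq].
  by rewrite word_act_eq eqxx mulr1; apply: eq_bigr => k _; rewrite ffunE invgK.
by rewrite word_act_eq (negPf neq) mulr0.
Qed.

(* A word [w] contributes only if [w (g k) <= w k] for all [k], hence only if
   [w] is constant on the cycles of [g]. *)
Lemma mxtrace_tens_trig M (g : 'S_m) : is_trig_mx M ->
  \tr (tens m M *m wrep g) = \tr (diag_tensor m (fun a => M a a) *m wrep g).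
Proof.
move=> /is_trig_mxP trigM.
have -> : diag_tensor m (fun a => M a a) = tens m (diag_mx (\row_a M a a)).
  rewrite tens_diag /diag_tensor; congr diag_mx; apply/rowP => i; rewrite !mxE.
  by apply: eq_bigr => k _; rewrite mxE.
rewrite !mxtrace_tens_word; apply: eq_bigr => w _.
have [k lt|ge] := pickP (fun k => w k < w (g k))%N.
  rewrite (bigD1 k) //= trigM // mul0r (bigD1 k) //= !mxE.
  by rewrite -val_eqE ltn_eqF // mulr0n mul0r.
(* The two sides of w (g k) <= w k have the same sum over [k], so equality holds for every [k]. *)
have eqw : forall k, w (g k) = w k :> nat.
  apply: eq_sum_leq => [k|]; first by rewrite leqNgt; move: (ge k) => /= ->.
  by rewrite [leqLHS](reindex_inj (@perm_inj _ g)).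
apply: eq_bigr => k _; rewrite !mxE.
by rewrite (ord_inj (eqw k)) eqxx mulr1n.
Qed.

Lemma mxtrace_diag_perm (x : 'I_n -> C) (s : 'S_n) (g : 'S_m) :
  \tr (diag_tensor m (x \o s) *m wrep g) = \tr (diag_tensor m x *m wrep g).
Proof.
have dE (y : 'I_n -> C) : diag_tensor m y = tens m (diag_mx (\row_a y a)).
  rewrite tens_diag /diag_tensor; congr diag_mx; apply/rowP => i; rewrite !mxE.
  by apply: eq_bigr => k _; rewrite mxE.
rewrite !dE !mxtrace_tens_word.
have bij : bijective (fun w : word => [ffun k => s (w k)] : word).
  exists (fun w : word => [ffun k => s^-1%g (w k)] : word) => w; apply/ffunP => k;
    by rewrite !ffunE ?permK ?permKV.
rewrite [RHS](reindex _ (onW_bij _ bij)) /=; apply: eq_bigr => w _.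
by apply: eq_bigr => k _; rewrite !ffunE !mxE (inj_eq perm_inj).
Qed.

Lemma prod_XsubC_perm (s t : seq C) :
  \prod_(x <- s) ('X - x%:P) = \prod_(x <- t) ('X - x%:P) -> perm_eq s t.
Proof.
elim: s t => [|x s IHs] t E.
  have := congr1 (fun p : {poly C} => size p) E.
  rewrite big_nil size_polyC oner_eq0 size_prod_XsubC => -[/esym/size0nil->] //.
have xt : x \in t.
  by rewrite -root_prod_XsubC -E root_prod_XsubC mem_head.
have pt := perm_to_rem xt.
rewrite (perm_trans _ (_ : perm_eq (x :: rem x t) t)) //; last by rewrite perm_sym.
rewrite perm_cons; apply: IHs.
move: E; rewrite (perm_big _ pt) /= !big_cons => /mulfI; apply.
by rewrite polyXsubC_eq0.
Qed.

Lemma char_poly_conj M (P : 'M[C]_n) : P \in unitmx ->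
  char_poly (P *m M *m invmx P) = char_poly M.
Proof.
move=> uP; rewrite /char_poly /char_poly_mx.
have PP : map_mx polyC P *m map_mx polyC (invmx P) = 1%:M.
  by rewrite -map_mxM mulmxV // map_mx1.
have -> : 'X%:M - map_mx polyC (P *m M *m invmx P)
    = map_mx polyC P *m ('X%:M - map_mx polyC M) *m map_mx polyC (invmx P).
  rewrite mulmxBr mulmxBl !map_mxM; congr (_ - _).
  by rewrite scalar_mxC -mulmxA PP mulmx1.
by rewrite !det_mulmx mulrAC -det_mulmx PP det1 mul1r.
Qed.

(** A unitary change of basis makes [M] triangular, and cancels in the trace because tensor powers
    commute with permutations of the positions. The diagonal then carries the [x i] in some order,
    which the trace does not see. *)
Lemma mxtrace_tens_eigen M (x : 'I_n -> C) (g : 'S_m) : (0 < n)%N ->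
    char_poly M = \prod_(i < n) ('X - (x i)%:P) ->
  \tr (tens m M *m wrep g) = \tr (diag_tensor m x *m wrep g).
Proof.
move=> n_gt0 chM; have [P uP trigT] := Schur M n_gt0.
have unP := unitarymx_unit uP.
set T := conjmx P M in trigT; have TE : T = P *m M *m invmx P by rewrite /T conjumx.
have -> : \tr (tens m M *m wrep g) = \tr (tens m T *m wrep g).
  rewrite TE !tens_mul -(mulmxA _ (tens m (invmx P))) (tens_word_comm (invmx P)) mulmxA.
  by rewrite [RHS]mxtrace_mulC !mulmxA -tens_mul mulVmx // tens1 mul1mx.
rewrite mxtrace_tens_trig //.
have : perm_eq [tuple x i | i < n] [tuple T i i | i < n].
  apply: prod_XsubC_perm; rewrite !big_map -!enumT !big_enum /= -chM.
  by rewrite -(char_poly_conj M unP) -TE char_poly_trig.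
case/tuple_permP => s xs.
rewrite -(mxtrace_diag_perm _ s); congr (\tr (diag_tensor m _ *m _)).
apply/funext => i; have := congr1 (fun u : seq C => nth 0 u i) xs.
by rewrite -!(tnth_nth 0) !tnth_mktuple.
Qed.

Lemma mxtrace_tens_ysym M (x : 'I_n -> C) eta : is_partition eta -> (0 < n)%N ->
    char_poly M = \prod_(i < n) ('X - (x i)%:P) ->
  \tr (tens m M *m ysym eta wrep) = ykappa C eta * schur eta x.
Proof.
move=> peta n_gt0 chM; rewrite -mxtrace_ysym_diag // [RHS]mxtrace_mulC ysymE.
rewrite !mulmx_sumr !mxtrace_sum; apply: eq_bigr => p _.
rewrite !mulmx_sumr !mxtrace_sum; apply: eq_bigr => q _.
by rewrite -!scalemxAr !mxtraceZ (mxtrace_tens_eigen _ n_gt0 chM).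
Qed.

End TensorTraces.

(** * Integration over the unitary group *)

Section HaarIntegral.
Import numFieldTopology.Exports.
Variables (R : realType) (n : nat).
Local Notation U := (unitary R n).
Local Notation UB := (unitary_borel R n).
Local Open Scope classical_set_scope.

Lemma unitary_entry_le1 (u : 'M[R[i]]_n) i j : u \is unitarymx -> `|u i j| <= 1.
Proof.
move=> /unitarymxP uu; have : (u *m u^t*) i i = 1 by rewrite uu mxE eqxx.
rewrite mxE (bigD1 j) //= !mxE -normCK => E.
have : `|u i j| ^+ 2 <= 1.
  rewrite -E lerDl sumr_ge0 // => k _; rewrite !mxE -normCK exprn_ge0 //.
by rewrite expr_le1.
Qed.

(** Stated for any 1-Lipschitz [f], so as to serve both the real and the imaginary part. *)
Lemma open_re_entry (i j : 'I_n) (f : R[i] -> R) (V : set R) :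
  (forall x y, `|f x - f y|%:C <= `|x - y|) -> open V ->
  open [set M : 'M[R[i]]_n | V (f (M i j))].
Proof.
move=> lipf oV; rewrite openE => M /= VM.
have /nbhs_ballP[e /= e0 eV] : nbhs (f (M i j)) V by apply: open_nbhs_nbhs.
apply/nbhs_ballP; exists e%:C => /=; first by rewrite ltcR.
move=> N [_ MN]; apply: eV; rewrite /ball /=.
by rewrite -ltcR; apply: le_lt_trans (lipf _ _) _; exact: MN.
Qed.

Lemma measurable_entry (i j : 'I_n) (f : R[i] -> R) :
  (forall x y, `|f x - f y|%:C <= `|x - y|) ->
  measurable_fun [set: UB] (fun u : UB => f (unitary_mx u i j)).
Proof.
move=> lipf; apply: (measurability _ (measurable_realfun.RGenOpens.measurableE R)).
move=> _ [_ [a [b ->]] <-]; rewrite setTI.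
apply: sub_sigma_algebra.
exists [set M : 'M[R[i]]_n | `]a, b[%classic (f (M i j))] => //.
by apply: open_re_entry => //; exact: interval_open.
Qed.

Lemma continuous_mulmx (g : 'M[R[i]]_n) (W : set 'M[R[i]]_n) :
  g \is unitarymx -> open W -> open [set M : 'M[R[i]]_n | W (g *m M)].
Proof.
move=> ug oW; rewrite openE => M /= WM.
have /nbhs_ballP[e /= e0 eW] : nbhs (g *m M) W by apply: open_nbhs_nbhs.
(* Entries of [g] have modulus at most 1, so an entry of the product moves by at most [n] radii;
   [n.+1] makes this less than [e] and keeps the divisor nonzero. *)
apply/nbhs_ballP; exists (e / n.+1%:R) => /=; first by rewrite divr_gt0.
move=> N [_ MN]; apply: eW; split=> // i j; rewrite /ball /= !mxE -sumrB.
apply: le_lt_trans (ler_norm_sum _ _ _) _.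
apply: (@le_lt_trans _ _ (\sum_(k < n) e / n.+1%:R)).
  apply: ler_sum => k _; rewrite -mulrBr normrM.
  rewrite -[leRHS]mul1r ler_pM // ?unitary_entry_le1 //.
  exact: ltW (MN k j).
rewrite sumr_const card_ord -[_ *+ n]mulr_natr -mulrA gtr_pMr // mulrC ltr_pdivrMr //.
by rewrite mul1r ltr_nat.
Qed.

Lemma measurable_unitary_mul (g : U) :
  measurable_fun [set: UB] (unitary_mul g : UB -> UB).
Proof.
apply: (@measurability _ _ UB UB setT _ (@open U)) => //.
move=> _ [V oV <-]; rewrite setTI; apply: sub_sigma_algebra.
have [W oW <-] := oV.
exists [set M : 'M[R[i]]_n | W (unitary_mx g *m M)] => //.
by apply: continuous_mulmx => //; exact: unitary_mxP.
Qed.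

(** This class is closed under sums, products and conjugation, and its members are integrable for a
    probability measure. *)
Definition bounded_measurable (f : UB -> R[i]) : Prop :=
  [/\ measurable_fun setT (fun u => complex.Re (f u)),
      measurable_fun setT (fun u => complex.Im (f u))
    & exists B : R, forall u, `|complex.Re (f u)| <= B /\ `|complex.Im (f u)| <= B].

Lemma ReD (x y : R[i]) : complex.Re (x + y) = complex.Re x + complex.Re y.
Proof. by case: x; case: y. Qed.

Lemma ImD (x y : R[i]) : complex.Im (x + y) = complex.Im x + complex.Im y.
Proof. by case: x; case: y. Qed.

Lemma ReM (x y : R[i]) :
  complex.Re (x * y) = complex.Re x * complex.Re y - complex.Im x * complex.Im y.
Proof. by case: x; case: y. Qed.

Lemma ImM (x y : R[i]) :
  complex.Im (x * y) = complex.Re x * complex.Im y + complex.Im x * complex.Re y.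
Proof. by case: x; case: y. Qed.

Lemma bounded_measurable_cst c : bounded_measurable (fun=> c).
Proof.
split; [exact: measurable_cst|exact: measurable_cst|].
exists (Num.max `|complex.Re c| `|complex.Im c|) => _.
by rewrite !le_max !lexx orbT.
Qed.

Lemma bounded_measurableD f g : bounded_measurable f -> bounded_measurable g ->
  bounded_measurable (fun u => f u + g u).
Proof.
move=> [rf jf [B Bf]] [rg jg [B' Bg]]; split.
- by under eq_fun do rewrite ReD; exact: measurable_funD.
- by under eq_fun do rewrite ImD; exact: measurable_funD.
exists (B + B') => u; rewrite ReD ImD.
by split; apply: le_trans (ler_normD _ _) _; rewrite lerD //;
  [case: (Bf u)|case: (Bg u)|case: (Bf u)|case: (Bg u)].
Qed.

Lemma bounded_measurableM f g : bounded_measurable f -> bounded_measurable g ->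
  bounded_measurable (fun u => f u * g u).
Proof.
move=> [rf jf [B Bf]] [rg jg [B' Bg]]; split.
- by under eq_fun do rewrite ReM; apply: measurable_funB; exact: measurable_funM.
- by under eq_fun do rewrite ImM; apply: measurable_funD; exact: measurable_funM.
exists (B * B' + B * B') => u; rewrite ReM ImM.
have [Rf If] := Bf u; have [Rg Ig] := Bg u.
split; [apply: le_trans (ler_normB _ _) _|apply: le_trans (ler_normD _ _) _];
  by rewrite !normrM lerD // ler_pM.
Qed.

Lemma bounded_measurable_prod (I : Type) (r : seq I) (f : I -> UB -> R[i]) :
  (forall i, bounded_measurable (f i)) -> bounded_measurable (fun u => \prod_(i <- r) f i u).
Proof.
move=> bf; elim: r => [|i r IHr].
  by under eq_fun do rewrite big_nil; exact: bounded_measurable_cst.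
by under eq_fun do rewrite big_cons; exact: bounded_measurableM.
Qed.

Lemma bounded_measurable_sum (I : Type) (r : seq I) (f : I -> UB -> R[i]) :
  (forall i, bounded_measurable (f i)) -> bounded_measurable (fun u => \sum_(i <- r) f i u).
Proof.
move=> bf; elim: r => [|i r IHr].
  by under eq_fun do rewrite big_nil; exact: bounded_measurable_cst.
by under eq_fun do rewrite big_cons; exact: bounded_measurableD.
Qed.

Lemma normc_ge_Im (x : R[i]) : `|complex.Im x|%:C <= `|x|.
Proof.
rewrite normc_def lecR -sqrtr_sqr ler_wsqrtr // lerDr sqr_ge0 //.
Qed.

Lemma bounded_measurable_entry i j : bounded_measurable (fun u : UB => unitary_mx u i j).
Proof.
split.
- apply: (@measurable_entry _ _ (fun x => complex.Re x)) => x y.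
  have -> : complex.Re x - complex.Re y = complex.Re (x - y) by case: x; case: y.
  exact: normc_ge_Re.
- apply: (@measurable_entry _ _ (fun x => complex.Im x)) => x y.
  have -> : complex.Im x - complex.Im y = complex.Im (x - y) by case: x; case: y.
  exact: normc_ge_Im.
exists 1 => u; have le1 := unitary_entry_le1 i j (unitary_mxP u).
by split; rewrite -lecR; [apply: le_trans (normc_ge_Re _) le1|apply: le_trans (normc_ge_Im _) le1].
Qed.

Lemma bounded_measurable_conj f : bounded_measurable f ->
  bounded_measurable (fun u => ((f u)^*)%R).
Proof.
move=> [rf jf [B Bf]].
have ReJ (x : R[i]) : complex.Re (x^*)%R = complex.Re x by case: x.
have ImJ (x : R[i]) : complex.Im (x^*)%R = - complex.Im x by case: x.
split.
- by under eq_fun do rewrite ReJ.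
- by under eq_fun do rewrite ImJ; exact: measurableT_comp.
by exists B => u; rewrite ReJ ImJ normrN.
Qed.

Variable mu : probability UB R.

Lemma bounded_integrable (f : UB -> R) (B : R) : measurable_fun setT f ->
  (forall u, `|f u| <= B) -> mu.-integrable setT (EFin \o f).
Proof.
move=> mf Bf; apply: measurable_bounded_integrable => //.
  by rewrite (le_lt_trans (probability_le1 _ _)) // ltry.
by exists B; split => [|M lt u _]; [exact: num_real|exact: le_trans (Bf u) (ltW lt)].
Qed.

Lemma bounded_measurable_integrable f : bounded_measurable f ->
  mu.-integrable setT (EFin \o (fun u => complex.Re (f u))) /\
  mu.-integrable setT (EFin \o (fun u => complex.Im (f u))).
Proof.
move=> [rf jf [B Bf]].
by split; apply: (@bounded_integrable _ B) => // u; case: (Bf u).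
Qed.

Lemma complex_integral_cst c : complex_integral mu (fun=> c) = c.
Proof.
have mu1 : fine (mu setT) = 1 by rewrite [mu setT]probability_setT.
by rewrite /complex_integral !Rintegral_cst // mu1 !mulr1; case: c.
Qed.

Lemma complex_integralD f g : bounded_measurable f -> bounded_measurable g ->
  complex_integral mu (fun u => f u + g u) = complex_integral mu f + complex_integral mu g.
Proof.
move=> /bounded_measurable_integrable[rf jf] /bounded_measurable_integrable[rg jg].
rewrite /complex_integral; under eq_Rintegral do rewrite ReD.
under [X in _ +i* X = _]eq_Rintegral do rewrite ImD.
by rewrite !RintegralD.
Qed.

Lemma complex_integralZ c f : bounded_measurable f ->
  complex_integral mu (fun u => c * f u) = c * complex_integral mu f.
Proof.
move=> /bounded_measurable_integrable[rf jf].
rewrite /complex_integral; under eq_Rintegral do rewrite ReM.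
under [X in _ +i* X = _]eq_Rintegral do rewrite ImM.
have Zr (a : R) (h : UB -> R) : mu.-integrable setT (EFin \o h) ->
    mu.-integrable setT (EFin \o (fun u => a * h u)).
  move=> ih; have := integrableZl measurableT a ih.
  by apply: eq_integrable => // u _.
rewrite RintegralB //; [|exact: Zr|exact: Zr].
rewrite RintegralD //; [|exact: Zr|exact: Zr].
by rewrite !RintegralZl //; case: c.
Qed.

Lemma complex_integral_sum (I : Type) (r : seq I) (f : I -> UB -> R[i]) :
  (forall i, bounded_measurable (f i)) ->
  complex_integral mu (fun u => \sum_(i <- r) f i u) = \sum_(i <- r) complex_integral mu (f i).
Proof.
move=> bf; elim: r => [|i r IHr].
  by rewrite big_nil -[RHS](complex_integral_cst 0); under eq_fun do rewrite big_nil.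
rewrite big_cons -IHr -complex_integralD //; last exact: bounded_measurable_sum.
by under eq_fun do rewrite big_cons.
Qed.

Hypothesis haar : normalized_haar mu.

(** The preimage of a set under translation by [g] is its image under translation by the inverse, so
    [mu] equals its pushforward by [g]. *)
Lemma Rintegral_invariant (g : U) (f : UB -> R) : measurable_fun setT f ->
  (exists B, forall u, `|f u| <= B) ->
  \int[mu]_(u in setT) f (unitary_mul g u) = \int[mu]_(u in setT) f u.
Proof.
move=> mf [B Bf]; rewrite /Rintegral; congr fine.
have ginvP : (unitary_mx g)^t* \in @unitary_mxs R n.
  by apply/mem_set; rewrite /unitary_mxs /= trmxC_unitary; exact: unitary_mxP.
pose ginv : U := @exist _ (fun x => x \in @unitary_mxs R n) _ ginvP.
have gK : cancel (unitary_mul ginv) (unitary_mul g).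
  move=> u; apply: val_inj => /=; rewrite mulmxA.
  by have /unitarymxP := unitary_mxP g => ->; rewrite mul1mx.
have gK' : cancel (unitary_mul g) (unitary_mul ginv).
  move=> u; apply: val_inj => /=; rewrite mulmxA.
  by have /unitarymxP/mulmx1C := unitary_mxP g => ->; rewrite mul1mx.
have mg := measurable_unitary_mul g.
transitivity (\int[pushforward mu (unitary_mul g : UB -> UB)]_(u in setT) (f u)%:E)%E.
  rewrite integral_pushforward //.
  - exact/measurable_EFinP.
  - apply: (@bounded_integrable (f \o unitary_mul g) B) => //.
      exact: measurableT_comp.
    by move=> u; apply: Bf.
unshelve refine (eq_measure_integral mu _) => [|S mS _]; first exact: mg.
rewrite /= /pushforward.
rewrite -(haar ginv mS); congr (mu _); apply/seteqP; split => u /=.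
  by move=> Su; exists (unitary_mul g u) => //; exact: gK'.
by move=> [v Sv <-]; rewrite gK.
Qed.

Lemma complex_integral_invariant (g : U) f : bounded_measurable f ->
  complex_integral mu (fun u => f (unitary_mul g u)) = complex_integral mu f.
Proof.
move=> [rf jf [B Bf]]; rewrite /complex_integral.
by rewrite (Rintegral_invariant g rf) ?(Rintegral_invariant g jf) //;
  exists B => u; case: (Bf u).
Qed.

End HaarIntegral.

(** * Entrywise integrals of matrix-valued functions *)

Section MatrixIntegral.
Variables (R : realType) (n : nat) (mu : probability (unitary_borel R n) R).
Local Notation UB := (unitary_borel R n).

Definition mx_integral N (f : UB -> 'M[R[i]]_N) : 'M[R[i]]_N :=
  \matrix_(i, j) complex_integral mu (fun u => f u i j).

Definition mx_bounded_measurable N (f : UB -> 'M[R[i]]_N) :=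
  forall i j, bounded_measurable (fun u => f u i j).

Lemma mx_bounded_measurable_cst N (M : 'M[R[i]]_N) : mx_bounded_measurable (fun=> M).
Proof. by move=> i j; apply: bounded_measurable_cst. Qed.

Lemma mx_bounded_measurable_mul N (f g : UB -> 'M[R[i]]_N) :
  mx_bounded_measurable f -> mx_bounded_measurable g ->
  mx_bounded_measurable (fun u => f u *m g u).
Proof.
move=> bf bg i j; under eq_fun do rewrite mxE.
by apply: bounded_measurable_sum => k; apply: bounded_measurableM.
Qed.

Lemma mx_integral_mull N (P : 'M[R[i]]_N) (f : UB -> 'M[R[i]]_N) :
  mx_bounded_measurable f -> mx_integral (fun u => P *m f u) = P *m mx_integral f.
Proof.
move=> bf; apply/matrixP => i j; rewrite !mxE; under eq_fun do rewrite mxE.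
rewrite complex_integral_sum => [|k]; last first.
  by apply: bounded_measurableM => //; apply: bounded_measurable_cst.
by apply: eq_bigr => k _; rewrite complex_integralZ // mxE.
Qed.

Lemma mx_integral_mulr N (P : 'M[R[i]]_N) (f : UB -> 'M[R[i]]_N) :
  mx_bounded_measurable f -> mx_integral (fun u => f u *m P) = mx_integral f *m P.
Proof.
move=> bf; apply/matrixP => i j; rewrite !mxE; under eq_fun do rewrite mxE.
rewrite complex_integral_sum => [|k]; last first.
  by apply: bounded_measurableM => //; apply: bounded_measurable_cst.
apply: eq_bigr => k _; rewrite mxE mulrC -complex_integralZ //.
by congr complex_integral; apply/funext => u; rewrite mulrC.
Qed.

Lemma mx_integral_comm N (M : 'M[R[i]]_N) (f : UB -> 'M[R[i]]_N) :
  mx_bounded_measurable f -> (forall u, f u *m M = M *m f u) ->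
  mx_integral f *m M = M *m mx_integral f.
Proof.
move=> bf fM; have -> := esym (mx_integral_mulr M bf).
have -> := esym (mx_integral_mull M bf).
by congr mx_integral; apply/funext.
Qed.

Lemma mxtrace_integral_mulr N (M : 'M[R[i]]_N) (f : UB -> 'M[R[i]]_N) c :
  mx_bounded_measurable f -> (forall u, \tr (f u *m M) = c) ->
  \tr (mx_integral f *m M) = c.
Proof.
move=> bf fM; rewrite -(complex_integral_cst mu c) -mx_integral_mulr //.
have bfM : mx_bounded_measurable (fun u => f u *m M).
  by apply: mx_bounded_measurable_mul => //; apply: mx_bounded_measurable_cst.
transitivity (complex_integral mu (fun u => \sum_k (f u *m M) k k)).
  rewrite complex_integral_sum => [|k]; last exact: bfM.
  by apply: eq_bigr => k _; rewrite mxE.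
by congr complex_integral; apply/funext => u; apply: fM.
Qed.

Lemma mx_bounded_measurable_tens_conj m (A : 'M[R[i]]_n) :
  mx_bounded_measurable (fun u => tens m (unitary_conj A u)).
Proof.
have bu : mx_bounded_measurable (fun u : UB => unitary_mx u).
  by move=> i j; apply: bounded_measurable_entry.
have bu' : mx_bounded_measurable (fun u : UB => (unitary_mx u)^t*).
  move=> i j; under eq_fun do rewrite !mxE.
  exact: bounded_measurable_conj (bu j i).
move=> i j; under eq_fun do rewrite mxE.
apply: bounded_measurable_prod => k.
by apply: mx_bounded_measurable_mul => //; apply: mx_bounded_measurable_mul => //;
  apply: mx_bounded_measurable_cst.
Qed.

(** Replacing [u] by [g u] conjugates A^u by [g], so [E] equals its own conjugate by the tensor
    power of [g]. *)
Lemma mx_integral_unitary m (A : 'M[R[i]]_n) (g : 'M[R[i]]_n) :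
    normalized_haar mu -> g \is unitarymx ->
  let E := mx_integral (fun u => tens m (unitary_conj A u)) in
  E *m tens m g = tens m g *m E.
Proof.
move=> haar gP E.
have gS : g \in @unitary_mxs R n by apply/mem_set.
pose gu : unitary R n := @exist _ (fun x => x \in @unitary_mxs R n) g gS.
have bf := @mx_bounded_measurable_tens_conj m A.
have conjE u : tens m (unitary_conj A (unitary_mul gu u))
    = tens m g *m tens m (unitary_conj A u) *m tens m (g^t*).
  rewrite -!tens_mul; congr tens; rewrite /unitary_conj /unitary_mul /unitary_mx /=.
  by rewrite trmx_mul map_mxM !mulmxA.
have E1 : E = tens m g *m E *m tens m (g^t*).
  rewrite -mx_integral_mull // -mx_integral_mulr; last first.
    by apply: mx_bounded_measurable_mul => //; apply: mx_bounded_measurable_cst.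
  apply/matrixP => i j; rewrite !mxE -(complex_integral_invariant haar gu) //.
  by congr complex_integral; apply/funext => u; rewrite conjE.
rewrite {1}E1 -!mulmxA -tens_mul.
have /unitarymxP/mulmx1C -> := gP.
by rewrite tens1 mulmx1.
Qed.

End MatrixIntegral.

(** * Evaluation of the integral through Young symmetrizers *)

Lemma schur1 (K : comNzRingType) m n (eta : {ffun 'I_m -> 'I_m.+1}) :
  schur eta (fun _ : 'I_n => 1 : K) = #|ssyt n eta|%:R.
Proof.
rewrite /schur -sum1_card natr_sum; apply: eq_big => [T|T _]; first by rewrite inE.
by rewrite big1.
Qed.

Theorem theorem9 (R : realType) (n m : nat) (m_gt0 : (0 < m)%N)
    (le_mn : (m <= n)%N) (mu : probability (unitary_borel R n) R)
    (mu_haar : normalized_haar mu) (A : 'M[R[i]]_n) (lambda : 'I_n -> R[i])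
    (eigA : char_poly A = \prod_(i < n) ('X - (lambda i)%:P))
    (sigma : 'S_m) :
  complex_integral mu
    (fun u => \prod_(i < m)
       unitary_conj A u (widen_ord le_mn i) (widen_ord le_mn (sigma i)))
  = \sum_(eta : {ffun 'I_m -> 'I_m.+1} | is_partition eta)
      schur eta lambda / schur eta (fun _ : 'I_n => 1 : R[i])
      * (sym_char eta R[i] 1%g / (m`!)%:R) * sym_char eta R[i] sigma.
Proof.
pose w0 : {ffun 'I_m -> 'I_n} := [ffun k => widen_ord le_mn k].
have inj0 : injective w0.
  by move=> k l; rewrite !ffunE => /(congr1 val) /= /ord_inj.
have inj_act : injective (word_act w0).
  move=> g h /ffunP eqgh; apply: invg_inj; apply/permP => k.
  by apply: inj0; have := eqgh k; rewrite !ffunE => /(congr1 val) /= /ord_inj ->.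
pose E := mx_integral mu (fun u => tens m (unitary_conj A u)).
have bE := @mx_bounded_measurable_tens_conj R n m A.
have Eu g : g \is unitarymx -> E *m tens m g = tens m g *m E.
  exact: mx_integral_unitary.
have Eword g : E *m word_repr R[i] m n g = word_repr R[i] m n g *m E.
  by apply: mx_integral_comm => // u; apply: tens_word_comm.
have EE := commutant_word Eu inj0.
(* [word_act] inverts its permutation, so acting by [s] turns [w0] into [w0 \o sigma]. *)
pose s := (sigma^-1)%g.
transitivity (E (enum_rank w0) (enum_rank (word_act w0 s))).
  rewrite mxE; congr complex_integral; apply/funext => u; rewrite mxE !enum_rankK.
  by apply: eq_bigr => k _; rewrite !ffunE invgK.
have n_gt0 : (0 < n)%N := leq_trans m_gt0 le_mn.
(* The integrand of this trace is constant, because A^u has the characteristic polynomial of [A] for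
   every [u]. *)
have trEY eta : is_partition eta ->
    \tr (E *m ysym eta (word_repr R[i] m n)) = ykappa R[i] eta * schur eta lambda.
  move=> peta; apply: mxtrace_integral_mulr => // u.
  apply: mxtrace_tens_ysym => //; rewrite -eigA /unitary_conj.
  have uP := unitary_mxP u.
  by rewrite -invmx_unitary // char_poly_conj // unitarymx_unit.
have EY eta : is_partition eta -> exists2 phi,
    E *m ysym eta (word_repr R[i] m n) = phi *: ysym eta (word_repr R[i] m n) &
    phi * #|ssyt n eta|%:R = schur eta lambda.
  move=> peta; have k0 := ykappa_neq0 R[i] peta.
  set Y := ysym eta _.
  pose t := \sum_g E (enum_rank w0) (enum_rank (word_act w0 g)) * ytheta R[i] eta g.
  (* [E] is a combination of permutations, so the sandwich rule applies term by term. *)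
  have YEY : Y *m E *m Y = t *: Y.
    rewrite [in LHS]EE mulmx_sumr mulmx_suml scaler_suml; apply: eq_bigr => g _.
    by rewrite -scalemxAr -scalemxAl ysym_sandwich // scalerA.
  have EYY : E *m Y = (t / ykappa R[i] eta) *: Y.
    apply: (scalerI k0); rewrite scalemxAr -(ysym_sqr _ peta) mulmxA.
    by rewrite (comm_ysym _ Eword) YEY scalerA mulrCA mulfV ?mulr1.
  exists (t / ykappa R[i] eta) => //; apply: (mulfI k0).
  (* Comparison of traces: phi kappa rank(Y) = kappa s_eta(lambda), where rank(Y) is the number of
     semistandard tableaux. *)
  rewrite -trEY // EYY mxtraceZ (mxtrace_quasi_idem_rank (ysym_sqr _ peta)).
  by rewrite (squeeze _ _ _).2 // mulrCA.
have [sum1 rankE] := squeeze R[i] m n.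
(* Inserting the sum of the isotypic projections splits the entry of [E] into one term for each
   partition. *)
rewrite -[E]mulmx1 -sum1 mulmx_sumr summxE; apply: eq_bigr => eta peta.
have [phi EYphi phiE] := EY _ peta.
have Ez : E *m zsym eta (word_repr R[i] m n) = phi *: zsym eta (word_repr R[i] m n).
  rewrite /zsym mulmx_sumr scaler_sumr; apply: eq_bigr => g _.
  by rewrite !mulmxA Eword -(mulmxA _ E) EYphi -scalemxAr -scalemxAl.
have zE : zsym eta (word_repr R[i] m n) (enum_rank w0) (enum_rank (word_act w0 s))
    = zcoef R[i] eta s.
  rewrite zsymE summxE (bigD1 s) //= !mxE !enum_rankK eqxx mulr1 big1 ?addr0 // => x neq.
  by rewrite !mxE !enum_rankK (inj_eq inj_act) eq_sym (negPf neq) mulr0.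
rewrite /isotypic -scalemxAr Ez !mxE zE schur1 -phiE.
have k0 := ykappa_neq0 R[i] peta.
have -> : sym_char eta R[i] 1%g / (m`!)%:R = (ykappa R[i] eta)^-1.
  apply: (mulfI k0); rewrite mulrA sym_char1 // !mulfV //.
have -> : sym_char eta R[i] sigma = (ykappa R[i] eta)^-1 * zcoef R[i] eta s.
  by rewrite -sym_char_zcoef // mulKf.
(* If the number of tableaux is 0 it cannot be cancelled; the symmetrizer then has rank 0, so
   [zcoef] and both sides vanish. *)
have [r0|rn0] := eqVneq #|ssyt n eta| 0%N; last first.
  by rewrite mulfK ?pnatr_eq0 // expr2 invfM mulrCA !mulrA.
have Y0 : ysym eta (word_repr R[i] m n) = 0.
  by apply/eqP; rewrite -mxrank_eq0 rankE // r0.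
have -> : zcoef R[i] eta s = 0.
  rewrite -zE (_ : zsym _ _ = 0) ?mxE // /zsym big1 // => g _.
  by rewrite Y0 mulmx0 mul0mx.
by rewrite !mulr0.
Qed.
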